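(* Let $E=(0,\infty)$. Suppose that $\inf_{y>0}\kappa(y)\ge\underline\kappa$ for some $\underline\kappa>0$ and that there are $C_*>0$ and $\alpha_1,\alpha_2\ge0$ with $|a(y)|+|\widetilde b(y)|+|\kappa(y)|\le C_*\big(1+\max\{y^{-\alpha_1},y^{\alpha_2}\}\big)$ for all $y>0$. For $0<\varepsilon<R$ let $h_{\varepsilon,R}$ denote the unique classical solution of $$\frac{a(y)^2}{2}h''+\widetilde b(y)h'-\kappa(y)h+\eta h^p=0\ \text{ in }(\varepsilon,R),\qquad h'(\varepsilon)=0,\quad h(R)=\frac1{\kappa(R)}.$$ Then there exist a sequence $R_n\to\infty$ and $h_\star\in C^{2,\alpha}((0,\infty))$ such that $h_\star$ solves $$\frac{a(y)^2}{2}h''(y)+\widetilde b(y)h'(y)-\kappa(y)h(y)+\eta h(y)^p=0,\qquad y>0,$$ and $h_{1/R_n,R_n}\to h_\star$ locally in $C^2((0,\infty))$. Moreover, for all $y>0$, $$\delta_0e^{-y-y^{-1}}\le h_\star(y)\le\overline h:=\max\Big\{\frac1{\underline\kappa},\Big(\frac{\eta}{\underline\kappa}\Big)^{1/(1-p)}\Big\},$$ where $\delta_0>0$ is the constant described in the context.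
   Context: Let $n\in\mathbb N$, $E=(0,\infty)$, $\alpha\in(0,1)$. Let $r,b\in C^{1,\alpha}(E;\mathbb R)$, $\mu\in C^{1,\alpha}(E;\mathbb R^n)$; $a:E\to\mathbb R$ and $\sigma:E\to\mathbb R^{n\times n}$ Borel; $\rho\in\mathbb R^n$ constant with $|\rho|\le1$; $a^2$, $\Sigma:=\sigma\sigma^\top$ and $\Upsilon:=a\sigma\rho$ of class $C^{2,\alpha}$ on $E$ (Hölder classes on open sets are local). For every $y\in E$, $\Sigma(y)$ is positive definite and $a(y)^2>0$. Standing assumption: for every initial point in $\mathbb R^n\times E$ the martingale problem on $C([0,\infty);\mathbb R^n\times E)$ for $\frac12\sum\widehat A_{ij}\partial_{ij}+\sum\widehat b_i\partial_i$, $\widehat A=\begin{pmatrix}\Sigma&\Upsilon\\ \Upsilon^\top&a^2\end{pmatrix}$, $\widehat b=(\mu^\top,b)^\top$ (coefficients evaluated at the last coordinate), has a unique solution. Parameters: $\delta\in\mathbb R$, $\beta>0$, $\psi,\gamma\in(0,\infty)\setminus\{1\}$, $\vartheta:=\frac{1-\gamma}{1-1/\psi}>0$. Put $\chi:=\frac{\gamma}{\gamma+(1-\gamma)\rho^\top\rho}>0$, $p:=1-\frac{\chi(\psi-1)}{1-\gamma}<1$, $\eta:=\frac{\beta^\psi(1-\gamma)}{\chi(\psi-1)}>0$, $\widetilde b:=b-(1-\frac1\gamma)\mu^\top\Sigma^{-1}\Upsilon$, $\kappa:=\frac{1-\gamma}{\chi(\psi-1)}\big[\delta\psi+(1-\psi)\big(r+\frac1{2\gamma}\mu^\top\Sigma^{-1}\mu\big)\big]$.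 A classical solution on $[\varepsilon,R]$ is a function in $C^2((\varepsilon,R))\cap C^1([\varepsilon,R])$ for which $h^p$ makes sense ($h\ge0$, and $h>0$ in the interior if $p<0$). Constant $\delta_0$: there are constants $\varepsilon_0\in(0,1)$ and $\delta_0>0$, independent of $\varepsilon$ and $R$, such that for every $R>1$ and $\varepsilon\in(0,\varepsilon_0)$ the classical solution satisfies $h_{\varepsilon,R}(y)\ge\delta_0\exp(-y-y^{-1})$ on $[\varepsilon,R]$. *)

(* Defs.v *)
From HB Require Import structures.
From mathcomp Require Import all_boot all_order all_algebra.
From mathcomp Require Import all_classical all_reals all_analysis.

Set Implicit Arguments.
Unset Strict Implicit.
Unset Printing Implicit Defensive.

Import Order.TTheory GRing.Theory Num.Theory.
Import numFieldTopology.Exports numFieldNormedType.Exports.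

Local Open Scope classical_set_scope.
Local Open Scope ring_scope.

Section Regularity.
Context {R : realType}.

Definition halfline : set R := `]0, +oo[.

(* [U] is meant to be open, so that the two-sided derivatives are those of the
   restriction of [f] to [U]. *)
Definition Ck (U : set R) (k : nat) (f : R -> R) : Prop :=
  (forall j x, (j < k)%N -> U x -> derivable (derive1n j f) x 1) /\
  (forall x, U x -> {for x, continuous (derive1n k f)}).

Definition locally_holder (U : set R) (alpha : R) (g : R -> R) : Prop :=
  forall K : set R, compact K -> K `<=` U ->
    exists C : R, forall x y, K x -> K y ->
      `|g x - g y| <= C * `|x - y| `^ alpha.

Definition Ckalpha (U : set R) (k : nat) (alpha : R) (f : R -> R) : Prop :=
  Ck U k f /\ locally_holder U alpha (derive1n k f).

(* Derivative of the restriction of [f] to [D]; one-sided at an end point of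
   [D] when [D] is an interval. *)
Definition derivative_within (D : set R) (f : R -> R) (x l : R) : Prop :=
  t^-1 * (f (x + t) - f x) @[t --> within [set t | D (x + t)] 0^'] --> l.

Definition C1_on (D : set R) (f : R -> R) : Prop :=
  exists df : R -> R, {within D, continuous df} /\
    forall x, D x -> derivative_within D f x (df x).

Definition cvg_locally_Ck (U : set R) (k : nat) (f_ : nat -> R -> R)
    (f : R -> R) : Prop :=
  forall (K : set R) (j : nat), compact K -> K `<=` U -> (j <= k)%N ->
    {uniform K, (fun m => derive1n j (f_ m)) @ \oo --> derive1n j f}.

End Regularity.

Section PathSpace.
Variables (R : realType) (n : nat).

(* A point (x, y) of R^n x R is the row vector [row_mx x y]. *)
Definition last_coord (x : 'rV[R]_(n + 1)) : R := rsubmx x 0 0.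

Definition state_space : set 'rV[R]_(n + 1) := [set x | 0 < last_coord x].

(* A continuous path indexed by [0, oo) is encoded by its extension to the whole
   line that is constant on ]-oo, 0]. *)
Definition path_set : set (R -> 'rV[R]_(n + 1)) :=
  [set w : R -> 'rV[R]_(n + 1) |
     [/\ continuous w, (forall t : R, t <= 0 -> w t = w 0)
       & forall t, state_space (w t)]].

Definition path_space : Type := {w : R -> 'rV[R]_(n + 1) | w \in path_set}.

HB.instance Definition _ := Choice.on path_space.

Fact path_set_cst : (fun=> const_mx 1) \in path_set.
Proof.
rewrite inE; split=> [|//|t]; first exact: cst_continuous.
by rewrite /state_space /last_coord /= !mxE.
Qed.

HB.instance Definition _ := isPointed.Build path_space
  (exist (fun w => w \in path_set) _ path_set_cst).

Definition path_at (w : path_space) (t : R) : 'rV[R]_(n + 1) := sval w t.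

Definition cylinder (I : set R) : set (set path_space) :=
  [set A | exists (u : R) (i : 'I_(n + 1)) (B : set R),
     [/\ I u, measurable B & A = [set w | B (path_at w u 0 i)]]].

Definition path_measurable : set (set path_space) := cylinder `[0, +oo[.

Definition canonical_filtration (t : R) : set (set path_space) :=
  <<s cylinder `[0, t] >>.

Definition path_law := probability (g_sigma_algebraType path_measurable) R.

Definition is_martingale (P : path_law) (M : R -> path_space -> R) : Prop :=
  [/\ forall t (B : set R), 0 <= t -> measurable B ->
        canonical_filtration t (M t @^-1` B),
      forall t, 0 <= t -> P.-integrable setT (fun w => (M t w)%:E)
    & forall s t A, 0 <= s -> s <= t -> canonical_filtration s A ->
        (\int[P]_(w in A) (M t w)%:E = \int[P]_(w in A) (M s w)%:E)%E].

Definition partial (i : 'I_(n + 1)) (f : 'rV[R]_(n + 1) -> R) :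
    'rV[R]_(n + 1) -> R :=
  fun x => 'D_(delta_mx 0 i) f x.

Definition test_function (f : 'rV[R]_(n + 1) -> R) : Prop :=
  [/\ forall i x, derivable f x (delta_mx 0 i),
      forall i, continuous (partial i f),
      forall i j x, derivable (partial j f) x (delta_mx 0 i),
      forall i j, continuous (partial i (partial j f))
    & compact (closure [set x | f x != 0]) /\
      closure [set x | f x != 0] `<=` state_space].

Definition generator (A : R -> 'M[R]_(n + 1)) (b : R -> 'cV[R]_(n + 1))
    (f : 'rV[R]_(n + 1) -> R) (x : 'rV[R]_(n + 1)) : R :=
  2^-1 * (\sum_i \sum_j A (last_coord x) i j * partial i (partial j f) x)
  + \sum_i b (last_coord x) i 0 * partial i f x.

Definition solves_martingale_problem (A : R -> 'M[R]_(n + 1))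
    (b : R -> 'cV[R]_(n + 1)) (x0 : 'rV[R]_(n + 1)) (P : path_law) : Prop :=
  P [set w | path_at w 0 = x0] = 1%E /\
  forall f, test_function f ->
    is_martingale P (fun t w =>
      f (path_at w t) - f (path_at w 0)
      - \int[lebesgue_measure]_(s in `[0, t]) generator A b f (path_at w s)).

(* Laws are compared on measurable sets only: the values of a measure elsewhere
   are irrelevant. *)
Definition well_posed (A : R -> 'M[R]_(n + 1)) (b : R -> 'cV[R]_(n + 1)) :
    Prop :=
  forall x0, state_space x0 ->
    exists P : path_law, solves_martingale_problem A b x0 P /\
      forall Q : path_law, solves_martingale_problem A b x0 Q ->
        forall B, path_measurable.-sigma.-measurable B -> Q B = P B.

End PathSpace.

Record market (R : realType) (n : nat) := Market {
  rate : R -> R;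
  drift : R -> 'cV[R]_n;
  vol : R -> 'M[R]_n;
  corr : 'cV[R]_n;
  fdrift : R -> R;
  fvol : R -> R }.

Record preferences (R : realType) := Preferences {
  delta : R;
  beta : R;
  psi : R;
  gamma : R }.

Section Model.
Context {R : realType} {n : nat}.
Variable m : market R n.

Definition euclidean_norm (v : 'cV[R]_n) : R := Num.sqrt ((v^T *m v) 0 0).

Definition positive_definite (S : 'M[R]_n) : Prop :=
  S^T = S /\ forall v : 'cV[R]_n, v != 0 -> 0 < (v^T *m S *m v) 0 0.

Definition Sigma (y : R) : 'M[R]_n := vol m y *m (vol m y)^T.

Definition Upsilon (y : R) : 'cV[R]_n := fvol m y *: (vol m y *m corr m).

Definition Ahat (y : R) : 'M[R]_(n + 1) :=
  block_mx (Sigma y) (Upsilon y) (Upsilon y)^T (fvol m y ^+ 2)%:M.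

Definition bhat (y : R) : 'cV[R]_(n + 1) :=
  col_mx (drift m y) (fdrift m y)%:M.

Definition standing_assumptions (alpha : R) : Prop :=
  [/\ [/\ Ckalpha halfline 1 alpha (rate m),
          Ckalpha halfline 1 alpha (fdrift m)
        & forall i, Ckalpha halfline 1 alpha (fun y => drift m y i 0)],
      [/\ measurable_fun halfline (fvol m),
          forall i j, measurable_fun halfline (fun y => vol m y i j)
        & euclidean_norm (corr m) <= 1],
      [/\ Ckalpha halfline 2 alpha (fun y => fvol m y ^+ 2),
          forall i j, Ckalpha halfline 2 alpha (fun y => Sigma y i j)
        & forall i, Ckalpha halfline 2 alpha (fun y => Upsilon y i 0)],
      forall y, 0 < y -> positive_definite (Sigma y) /\ 0 < fvol m y ^+ 2
    & well_posed Ahat bhat].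

Variable u : preferences R.

Definition vartheta : R := (1 - gamma u) / (1 - (psi u)^-1).

Definition preference_assumptions : Prop :=
  [/\ 0 < beta u, 0 < psi u /\ psi u != 1, 0 < gamma u /\ gamma u != 1
    & 0 < vartheta].

Definition chi : R :=
  gamma u / (gamma u + (1 - gamma u) * ((corr m)^T *m corr m) 0 0).

(* The exponent p of the nonlinearity. *)
Definition expo : R := 1 - chi * (psi u - 1) / (1 - gamma u).

Definition eta : R :=
  beta u `^ psi u * (1 - gamma u) / (chi * (psi u - 1)).

Definition btilde (y : R) : R :=
  fdrift m y - (1 - (gamma u)^-1)
    * ((drift m y)^T *m invmx (Sigma y) *m Upsilon y) 0 0.

Definition kappa (y : R) : R :=
  (1 - gamma u) / (chi * (psi u - 1))
  * (delta u * psi u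
     + (1 - psi u)
       * (rate m y + (2 * gamma u)^-1
            * ((drift m y)^T *m invmx (Sigma y) *m drift m y) 0 0)).

(* With [powR], 0 `^ p is 0 for p > 0 and 1 for p = 0. *)
Definition solves_ode (f : R -> R) (y : R) : Prop :=
  fvol m y ^+ 2 / 2 * derive1n 2 f y + btilde y * derive1n 1 f y - kappa y * f y
  + eta * f y `^ expo = 0.

(* [f] is only significant on [`[eps, rad]]. *)
Definition classical_solution (eps rad : R) (f : R -> R) : Prop :=
  [/\ Ck `]eps, rad[ 2 f /\ C1_on `[eps, rad] f,
      (forall y, y \in `[eps, rad] -> 0 <= f y) /\
      (expo < 0 -> forall y, y \in `]eps, rad[ -> 0 < f y),
      forall y, y \in `]eps, rad[ -> solves_ode f y,
      derivative_within `[eps, rad] f eps 0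
    & f rad = (kappa rad)^-1].

Definition unique_classical_solution (eps rad : R) (f : R -> R) : Prop :=
  classical_solution eps rad f /\
  forall g, classical_solution eps rad g ->
    forall y, y \in `[eps, rad] -> g y = f y.

Definition hbar (kappa0 : R) : R :=
  Num.max kappa0^-1 ((eta / kappa0) `^ (1 - expo)^-1).

End Model.

(* Main.v *)
(* A solution of the linear-growth equation h'' = -A h' + B h - D h^p on (0, oo)
   is determined by its Cauchy data (h(1), h'(1)), continuously and uniformly on
   compact intervals (Gronwall for (f - g)^2 + (f' - g')^2) as long as the values
   stay in a fixed [d, H] with d > 0, where h^p is Lipschitz. So no Arzela-Ascoli
   argument is needed: it suffices to extract a subsequence along which the Cauchy
   data converge. The data are bounded because h <= hbar, by the maximum
   principle, and because the mean value theorem on [1, 2] bounds h' at some point,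
   whence everywhere on [1, 2] by Gronwall for 1 + h'^2. Finally all coefficients
   are locally Lipschitz, so the equation makes h_star'' locally Lipschitz, hence
   locally alpha-Hoelder. *)

Require Import Defs.
From HB Require Import structures.
From mathcomp Require Import all_boot all_order all_algebra.
From mathcomp Require Import all_classical all_reals all_analysis.
From mathcomp Require Import ring lra.

Set Implicit Arguments.
Unset Strict Implicit.
Unset Printing Implicit Defensive.

Import Order.TTheory GRing.Theory Num.Theory.
Import numFieldTopology.Exports numFieldNormedType.Exports.

Local Open Scope classical_set_scope.
Local Open Scope ring_scope.

(** * Mean value estimates and Gronwall's inequality on a compact interval *)

Section MeanValue.
Context {R : realType}.
Implicit Types (f : R -> R) (a b x y : R).

Lemma derivable_continuous f x : derivable f x 1 -> {for x, continuous f}.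
Proof. by move=> df; apply/differentiable_continuous/derivable1_diffP. Qed.

Lemma is_derive_derive1 f x : derivable f x 1 -> is_derive x 1 f (derive1 f x).
Proof. by move=> df; rewrite derive1E; exact/derivableP. Qed.

Lemma mean_value f a b : a <= b ->
  (forall x, a <= x <= b -> derivable f x 1) ->
  exists2 c, a <= c <= b & f b - f a = derive1 f c * (b - a).
Proof.
move=> ab df.
have [||c cab fE] := @MVT_segment _ f (derive1 f) a b ab.
- move=> x xab; apply/is_derive_derive1/df.
  by move: xab; rewrite in_itv/= => /andP[/ltW-> /ltW->].
- by apply: derivable_within_continuous => x; rewrite in_itv/=; exact: df.
by exists c => //; move: cab; rewrite in_itv.
Qed.

Lemma mean_value_le f a b M :
  (forall x, a <= x <= b -> derivable f x 1) ->
  (forall x, a <= x <= b -> `|derive1 f x| <= M) ->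
  forall x y, a <= x <= b -> a <= y <= b -> `|f x - f y| <= M * `|x - y|.
Proof.
move=> df fM x y; wlog yx : x y / y <= x => [hw|].
  by case: (leP y x) => [/hw//|/ltW /hw xy] xab yab; rewrite distrC (distrC x) xy.
move=> /andP[ax xb] /andP[ay yb].
have [|c /andP[yc cx] ->] := @mean_value f y x yx.
  by move=> z /andP[yz zx]; apply: df; rewrite (le_trans ay)//= (le_trans zx).
rewrite normrM ler_wpM2r// fM//.
by rewrite (le_trans ay)//= (le_trans cx).
Qed.

(** The product of [f] with [exp(-K z)] is nonincreasing and its product with [exp(K z)] is
    nondecreasing, so the estimate holds for [y] on either side of [x]. *)
Lemma gronwall f a b K :
  (forall x, a <= x <= b -> derivable f x 1) ->
  (forall x, a <= x <= b -> `|derive1 f x| <= K * f x) ->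
  forall x y, a <= x <= b -> a <= y <= b -> f y <= f x * expR (K * `|y - x|).
Proof.
move=> df fK.
(* The sign [s] is 1 for [y] to the right of [x] and -1 for [y] to the left; both directions share
   one argument. *)
have key (s : R) : `|s| = 1 -> forall x y, a <= x <= b -> a <= y <= b ->
    0 <= s * (y - x) -> f y <= f x * expR (K * (s * (y - x))).
  move=> s1.
  have ss : s * s = 1 by rewrite -expr2 -real_normK ?num_real// s1 expr1n.
  pose g := fun z => f z * expR (- (K * s) * z).
  have dg z : a <= z <= b ->
      is_derive z 1 g ((derive1 f z - K * s * f z) * expR (- (K * s) * z)).
    move=> /df/is_derive_derive1 dfz.
    rewrite /g.
    have -> : (derive1 f z - K * s * f z) * expR (- (K * s) * z) =
      f z *: (- (K * s) * expR (- (K * s) * z))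
        + expR (- (K * s) * z) *: derive1 f z.
      by rewrite /GRing.scale/=; ring.
    apply: is_deriveM.
    have -> : (- (K * s) * expR (- (K * s) * z))
        = expR (- (K * s) * z) * - (K * s) by rewrite mulrC.
    apply: (@is_derive1_comp _ expR (fun z => - (K * s) * z)).
    by rewrite -[X in is_derive _ _ _ X]mulr1; exact: is_deriveZ.
  have main x y : a <= x <= b -> a <= y <= b -> 0 <= s * (y - x) -> g y <= g x.
    move=> xab yab sxy.
    suff [c [cab ->]] : exists c, a <= c <= b /\
        g y = g x + derive1 g c * (y - x).
      have /dg[dgc] := cab; rewrite -derive1E => ->.
      rewrite -lerBrDl subrr -[y - x]mul1r -ss.
      (* Since [s * s = 1], the increment of [g] is [s g'(c)] times [s (y - x)]: a nonpositive
         factor times a nonnegative one. *)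
      have -> : (derive1 f c - K * s * f c) * expR (- (K * s) * c) * (s * s * (y - x)) =
        (s * derive1 f c - (s * s) * (K * f c)) * (expR (- (K * s) * c) * (s * (y - x))) by ring.
      rewrite ss mul1r; apply: mulr_le0_ge0; last first.
        by rewrite mulr_ge0// expR_ge0.
      rewrite subr_le0 (le_trans (ler_norm _))// normrM s1 mul1r.
      exact: fK.
    have dgd z : a <= z <= b -> derivable g z 1 by move=> /dg[].
    move: xab yab => /andP[ax xb] /andP[ay yb].
    case: (leP x y) => [xy|/ltW xy].
      have [|c /andP[xc cy] gE] := @mean_value g x y xy.
        by move=> z /andP[xz zy]; apply: dgd; rewrite (le_trans ax)//= (le_trans zy).
      exists c; rewrite (le_trans ax)//= (le_trans cy)//; split=> //.
      by rewrite -gE addrC subrK.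
    have [|c /andP[xc cy] gE] := @mean_value g y x xy.
      by move=> z /andP[xz zy]; apply: dgd; rewrite (le_trans ay)//= (le_trans zy).
    exists c; rewrite (le_trans ay)//= (le_trans cy)//; split=> //.
    by rewrite -(opprB x y) mulrN -gE opprB addrC subrK.
  move=> x y xab yab sxy; have := main _ _ xab yab sxy.
  rewrite /g -(ler_pM2r (expR_gt0 (K * s * y))) -(mulrA (f y)) -(mulrA (f x)).
  rewrite -!expRD [- (K * s) * y + _](_ : _ = 0) ?expR0 ?mulr1; last by ring.
  by congr (_ <= _ * expR _); ring.
move=> x y xab yab; case: (lerP x y) => xy.
  by have := key 1 (normr1 _) x y xab yab; rewrite !mul1r subr_ge0 xy; exact.
have := key (-1) (normrN1 _) x y xab yab.
by rewrite mulN1r opprB subr_ge0 (ltW xy); exact.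
Qed.

End MeanValue.

(** * Functions that are Lipschitz on compact subintervals of the half-line *)

Section LocallyLipschitz.
Context {R : realType}.
Implicit Types f g : R -> R.

(** This class is stable under the algebra that builds the coefficients of the equation, and strong
    enough for Gronwall's inequality. For [b < a] the condition is empty. *)
Definition locally_lipschitz f := forall a b, 0 < a ->
  exists2 C, 0 <= C &
    forall x y, a <= x <= b -> a <= y <= b -> `|f x - f y| <= C * `|x - y|.

Lemma locally_lipschitz_bounded f a b : locally_lipschitz f -> 0 < a ->
  exists2 M, 0 <= M & forall x, a <= x <= b -> `|f x| <= M.
Proof.
move=> lf a0; have [C C0 fC] := lf a b a0.
exists (`|f a| + C * `|b - a|) => [|x /andP[ax xb]].
  by rewrite addr_ge0// mulr_ge0.
rewrite -[f x](subrK (f a)) addrC (le_trans (ler_normD _ _))// lerD2l.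
rewrite (le_trans (fC _ _ _ _)) ?lexx ?ax ?(le_trans ax)//.
by rewrite ler_wpM2l// !ger0_norm ?subr_ge0 ?(le_trans ax)// lerB.
Qed.

Lemma locally_lipschitz_continuous f x :
  locally_lipschitz f -> 0 < x -> {for x, continuous f}.
Proof.
move=> lf x0; have x20 : 0 < x / 2 by rewrite divr_gt0.
have [C C0 fC] := lf (x / 2) (x + x / 2) x20.
apply/cvgrPdist_le => e e0.
(* [C] may vanish, hence the division by [C + 1]. *)
have C1 : 0 < C + 1 by rewrite ltr_wpDl.
near=> y.
have xy : `|x - y| <= x / 2.
  by near: y; apply: (@cvgr_dist_le _ _ _ _ _ id) => //; exact: cvg_id.
have xye : `|x - y| <= e / (C + 1).
  by near: y; apply: (@cvgr_dist_le _ _ _ _ _ id); [exact: cvg_id|exact: divr_gt0].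
rewrite (le_trans (fC _ _ _ _))//.
- by lra.
- by move: xy; rewrite ler_norml; lra.
rewrite (@le_trans _ _ ((C + 1) * `|x - y|))// ?ler_wpM2r// ?lerDl//.
by rewrite mulrC -ler_pdivlMr.
Unshelve. all: by end_near. Qed.

Lemma eq_locally_lipschitz f g : (forall x, 0 < x -> f x = g x) ->
  locally_lipschitz f -> locally_lipschitz g.
Proof.
move=> fg lf a b a0; have [C C0 fC] := lf a b a0; exists C => // x y xab yab.
have [/andP[ax _] /andP[ay _]] := (xab, yab).
by rewrite -!fg ?(lt_le_trans a0)//; exact: fC.
Qed.

Lemma locally_lipschitz_cst (c : R) : locally_lipschitz (fun=> c).
Proof.
by move=> a b a0; exists 0 => // x y _ _; rewrite subrr normr0 mul0r.
Qed.

Lemma locally_lipschitzD f g : locally_lipschitz f -> locally_lipschitz g ->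
  locally_lipschitz (fun x => f x + g x).
Proof.
move=> lf lg a b a0; have [C C0 fC] := lf a b a0; have [D D0 gD] := lg a b a0.
exists (C + D) => [|x y xab yab]; first exact: addr_ge0.
by rewrite opprD addrACA mulrDl (le_trans (ler_normD _ _))// lerD ?fC ?gD.
Qed.

Lemma locally_lipschitzM f g : locally_lipschitz f -> locally_lipschitz g ->
  locally_lipschitz (fun x => f x * g x).
Proof.
move=> lf lg a b a0; have [C C0 fC] := lf a b a0; have [D D0 gD] := lg a b a0.
have [M M0 fM] := locally_lipschitz_bounded b lf a0.
have [N N0 gN] := locally_lipschitz_bounded b lg a0.
exists (M * D + N * C) => [|x y xab yab]; first by rewrite addr_ge0// mulr_ge0.
have -> : f x * g x - f y * g y = f x * (g x - g y) + g y * (f x - f y) by ring.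
rewrite mulrDl (le_trans (ler_normD _ _))// !normrM -!mulrA.
by apply: lerD; apply: ler_pM; rewrite ?normr_ge0 ?fM ?gN ?fC ?gD.
Qed.

Lemma locally_lipschitzN f : locally_lipschitz f ->
  locally_lipschitz (fun x => - f x).
Proof.
move=> lf; apply: (eq_locally_lipschitz (f := fun x => -1 * f x)).
  by move=> x _; rewrite mulN1r.
by apply: locally_lipschitzM => //; exact: locally_lipschitz_cst.
Qed.

(** On [[a, b]] the continuous function [|f|] has a positive minimum [|f c|], which gives the
    Lipschitz constant [C / |f c|^2] for the inverse. *)
Lemma locally_lipschitzV f : (forall x, 0 < x -> f x != 0) ->
  locally_lipschitz f -> locally_lipschitz (fun x => (f x)^-1).
Proof.
move=> f0 lf a b a0; have [ab|ba] := leP a b; last first.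
  exists 0 => // x y /andP[ax xb].
  by move: ba; rewrite ltNge (le_trans ax xb).
have [|c] := @EVT_min _ (fun x => `|f x|) a b ab.
  apply: continuous_in_subspaceT => x; rewrite inE/= in_itv/= => /andP[ax _].
  apply: cvg_norm; apply: locally_lipschitz_continuous => //.
  exact: lt_le_trans ax.
rewrite in_itv/= => /andP[ac cb] fc.
have fc0 : 0 < `|f c| by rewrite normr_gt0 f0// (lt_le_trans a0).
have [C C0 fC] := lf a b a0; exists (`|f c| ^- 2 * C) => [|x y xab yab].
  by rewrite mulr_ge0// invr_ge0 exprn_ge0.
have fp z : a <= z <= b -> (f z != 0) * (`|f z|^-1 <= `|f c|^-1).
  move=> zab; have z0 : 0 < z by move: zab => /andP[/(lt_le_trans a0)].
  split; first exact: f0.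
  by rewrite lef_pV2 ?posrE ?(normr_gt0 (f z)) ?f0//; apply: fc; rewrite in_itv.
have -> : (f x)^-1 - (f y)^-1 = (f x)^-1 * (f y)^-1 * (f y - f x).
  by field; rewrite (fp y yab).1 (fp x xab).1.
rewrite normrM -mulrA distrC; apply: ler_pM; rewrite ?fC//.
by rewrite normrM !normfV -exprVn expr2 ler_pM ?invr_ge0 ?fp.
Qed.

Lemma locally_lipschitz_sum (I : Type) (r : seq I) (P : pred I) (F : I -> R -> R) :
  (forall i, P i -> locally_lipschitz (F i)) ->
  locally_lipschitz (fun x => \sum_(i <- r | P i) F i x).
Proof.
move=> lF; elim: r => [|i r IH].
  apply: (eq_locally_lipschitz _ (locally_lipschitz_cst 0)) => x _.
  by rewrite big_nil.
have [Pi|Pi] := boolP (P i).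
  apply: (eq_locally_lipschitz _ (locally_lipschitzD (lF _ Pi) IH)) => x _.
  by rewrite big_cons Pi.
by apply: (eq_locally_lipschitz _ IH) => x _; rewrite big_cons (negbTE Pi).
Qed.

Lemma locally_lipschitz_prod (I : Type) (r : seq I) (P : pred I) (F : I -> R -> R) :
  (forall i, P i -> locally_lipschitz (F i)) ->
  locally_lipschitz (fun x => \prod_(i <- r | P i) F i x).
Proof.
move=> lF; elim: r => [|i r IH].
  apply: (eq_locally_lipschitz _ (locally_lipschitz_cst 1)) => x _.
  by rewrite big_nil.
have [Pi|Pi] := boolP (P i).
  apply: (eq_locally_lipschitz _ (locally_lipschitzM (lF _ Pi) IH)) => x _.
  by rewrite big_cons Pi.
by apply: (eq_locally_lipschitz _ IH) => x _; rewrite big_cons (negbTE Pi).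
Qed.

Definition mx_locally_lipschitz (m n : nat) (A : R -> 'M[R]_(m, n)) :=
  forall i j, locally_lipschitz (fun x => A x i j).

Lemma mx_locally_lipschitzM (m n p : nat) (A : R -> 'M[R]_(m, n))
    (B : R -> 'M[R]_(n, p)) :
  mx_locally_lipschitz A -> mx_locally_lipschitz B ->
  mx_locally_lipschitz (fun x => A x *m B x).
Proof.
move=> lA lB i j.
have : locally_lipschitz (fun x => \sum_k A x i k * B x k j).
  by apply: locally_lipschitz_sum => k _; apply: locally_lipschitzM.
by apply: eq_locally_lipschitz => x _; rewrite mxE.
Qed.

Lemma mx_locally_lipschitz_tr (m n : nat) (A : R -> 'M[R]_(m, n)) :
  mx_locally_lipschitz A -> mx_locally_lipschitz (fun x => (A x)^T).
Proof.
by move=> lA i j; apply: eq_locally_lipschitz (lA j i) => x _; rewrite mxE.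
Qed.

Lemma locally_lipschitz_det (n : nat) (A : R -> 'M[R]_n) :
  mx_locally_lipschitz A -> locally_lipschitz (fun x => \det (A x)).
Proof.
move=> lA; rewrite /determinant; apply: locally_lipschitz_sum => s _.
apply: locally_lipschitzM; first exact: locally_lipschitz_cst.
by apply: locally_lipschitz_prod.
Qed.

(** By Cramer's rule the entries of the inverse are cofactors divided by the determinant, and both
    are polynomials in the entries of [A]. *)
Lemma mx_locally_lipschitz_invmx (n : nat) (A : R -> 'M[R]_n) :
  (forall x, 0 < x -> A x \in unitmx) ->
  mx_locally_lipschitz A -> mx_locally_lipschitz (fun x => invmx (A x)).
Proof.
move=> uA lA i j.
have : locally_lipschitz (fun x => (\det (A x))^-1 *
    ((-1) ^+ (j + i) * \det (row' j (col' i (A x))))).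
  apply: locally_lipschitzM.
    apply: locally_lipschitzV => [x x0|]; last exact: locally_lipschitz_det.
    by have := uA x x0; rewrite unitmxE unitfE.
  apply: locally_lipschitzM; first exact: locally_lipschitz_cst.
  apply: locally_lipschitz_det => k l.
  by apply: eq_locally_lipschitz (lA (lift j k) (lift i l)) => x _; rewrite !mxE.
by apply: eq_locally_lipschitz => x x0; rewrite /invmx uA// !mxE.
Qed.

(** The maximum of [|f'|] on a compact interval is a Lipschitz constant there. *)
Lemma C1_locally_lipschitz f :
  (forall x, 0 < x -> derivable f x 1) ->
  (forall x, 0 < x -> {for x, continuous (derive1 f)}) ->
  locally_lipschitz f.
Proof.
move=> df cf a b a0; have [ab|ba] := leP a b; last first.
  exists 0 => // x y /andP[ax xb].
  by move: ba; rewrite ltNge (le_trans ax xb).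
have [|c _ fc] := @EVT_max _ (fun x => `|derive1 f x|) a b ab.
  apply: continuous_in_subspaceT => x; rewrite inE/= in_itv/= => /andP[ax _].
  by apply: cvg_norm; apply: cf; exact: lt_le_trans ax.
exists `|derive1 f c| => //; apply: mean_value_le => x => [/andP[ax _]|xab].
  by apply: df; exact: lt_le_trans ax.
by apply: fc; rewrite in_itv.
Qed.

Lemma Ckalpha_locally_lipschitz k alpha f :
  Ckalpha halfline k.+1 alpha f -> locally_lipschitz f.
Proof.
case=> -[df cf] _; have h (x : R) : 0 < x -> halfline x.
  by rewrite /halfline/= in_itv/= andbT.
apply: C1_locally_lipschitz => x x0; first exact: (df 0%N x isT (h _ x0)).
case: k df cf => [|k] df cf; first exact: (cf x (h _ x0)).
exact/derivable_continuous/(df 1%N x isT (h _ x0)).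
Qed.

Lemma compact_halfline (K : set R) : compact K -> K `<=` halfline ->
  exists a b, [/\ 0 < a, a <= b & K `<=` [set x | a <= x <= b]].
Proof.
move=> cK Kh; have [K0|/set0P K0] := eqVneq K set0.
  (* The empty set lies in any interval; [[1, 1]] serves. *)
  by exists 1, 1; rewrite K0; split => // x [].
have cid : {within K, continuous (@id R)}.
  by apply: continuous_subspaceT => x; exact: cvg_id.
have [a aK Ka] := compact_EVT_min K0 cK cid.
have [b bK Kb] := compact_EVT_max K0 cK cid.
exists a, b; split; last by move=> x /mem_set xK/=; rewrite Ka// Kb.
  by move: aK; rewrite inE => /Kh; rewrite /halfline/= in_itv/= andbT.
exact: Ka.
Qed.

(** On [[a, b]] one has [|x - y| = |x - y|^(1 - alpha) |x - y|^alpha], and the first factor is at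
    most [(b - a)^(1 - alpha)]. *)
Lemma locally_lipschitz_locally_holder alpha f : 0 < alpha < 1 ->
  locally_lipschitz f -> locally_holder halfline alpha f.
Proof.
move=> /andP[al0 al1] lf K cK /(compact_halfline cK)[a [b [a0 ab Kab]]].
have [C C0 fC] := lf a b a0.
exists (C * (b - a) `^ (1 - alpha)) => x y Kx Ky.
have [xab yab] := (Kab _ Kx, Kab _ Ky).
apply: (le_trans (fC x y xab yab)); rewrite -mulrA ler_wpM2l//.
have [->|xy] := eqVneq `|x - y| 0; first by rewrite mulr_ge0// powR_ge0.
rewrite -[leLHS]powRr1// -[X in _ `^ X <= _](subrK alpha) powRD ?xy ?implybT//.
rewrite ler_wpM2r ?powR_ge0// ge0_ler_powR ?nnegrE ?subr_ge0 ?(ltW al1)//.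
move: xab yab => /= /andP[ax xb] /andP[ay yb].
by rewrite ler_norml opprB !lerB.
Qed.

End LocallyLipschitz.

(** * Uniform limits on compact intervals, their derivatives, and extraction of subsequences *)

Section LocallyUniformLimits.
Context {R : realType}.
Implicit Types (F : nat -> R -> R) (f g : R -> R).

Definition ucvg_on (a b : R) F f := forall e, 0 < e ->
  exists N, forall k, (N <= k)%N -> forall x, a <= x <= b -> `|F k x - f x| <= e.

Lemma ucvg_on_cvg a b F f x : ucvg_on a b F f -> a <= x <= b ->
  F k x @[k --> \oo] --> f x.
Proof.
move=> Ff xab; apply/cvgrPdist_le => e /Ff[N FN].
by near=> k; rewrite distrC FN//; near: k; exact: nbhs_infty_ge.
Unshelve. all: by end_near. Qed.

Lemma ucvg_on_uniform (K : set R) a b F f :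
  K `<=` [set x | a <= x <= b] -> ucvg_on a b F f ->
  {uniform K, F @ \oo --> f}.
Proof.
move=> Kab Ff; move=> P /uniform_nbhs[E [entE sEP]].
have [e /= e0 eE] : exists2 e : R, 0 < e & [set xy | ball xy.1 e xy.2] `<=` E.
  by move: entE; rewrite -entourage_ballE.
have [|N FN] := Ff (e / 2); first by rewrite divr_gt0.
rewrite !nbhs_simpl /=; near=> k; apply: sEP => y /Kab/= yab; apply: eE.
rewrite /ball/= /ball_ distrC (le_lt_trans (FN k _ _ yab))//.
  by near: k; exact: nbhs_infty_ge.
by rewrite ltr_pdivrMr// ltr_pMr// ltr1n.
Unshelve. all: by end_near. Qed.

Lemma eq_ucvg_on a b F G f g : (exists N, forall k, (N <= k)%N ->
    forall x, a <= x <= b -> F k x = G k x) ->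
  (forall x, a <= x <= b -> f x = g x) -> ucvg_on a b F f -> ucvg_on a b G g.
Proof.
move=> [M FG] fg Ff e /Ff[N FN]; exists (maxn M N) => k.
by rewrite geq_max => /andP[Mk Nk] x xab; rewrite -FG// -fg//; exact: FN.
Qed.

(** Completeness gives the pointwise limit; letting [l] tend to infinity in the Cauchy estimate
    makes the convergence uniform. *)
Lemma ucauchy_on_ucvg a b F :
  (forall e, 0 < e -> exists N, forall k l, (N <= k)%N -> (N <= l)%N ->
    forall x, a <= x <= b -> `|F k x - F l x| <= e) ->
  ucvg_on a b F (fun x => limn (F ^~ x)).
Proof.
move=> cF e e0; have [N FN] := cF e e0; exists N => k Nk x xab.
have cx : cvgn (F ^~ x).
  apply/cauchy_cvgP/cauchyP => d d0.
  have [|M FM] := cF (d / 2); first by rewrite divr_gt0.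
  exists (F M x); rewrite /= nbhs_simpl; near=> l.
  rewrite /= /ball/= (@le_lt_trans _ _ (d / 2))//.
    by apply: FM => //; near: l; exact: nbhs_infty_ge.
  by rewrite ltr_pdivrMr// ltr_pMr// ltr1n.
have lx : `|F k x - F l x| @[l --> \oo] --> `|F k x - limn (F ^~ x)|.
  by apply: cvg_norm; apply: cvgB => //; exact: cvg_cst.
rewrite -(cvg_lim (@Rhausdorff R) lx); apply: limr_le.
  by apply/cvg_ex; exists `|F k x - limn (F ^~ x)|.
by near=> l; apply: FN => //; near: l; exact: nbhs_infty_ge.
Unshelve. all: by end_near. Qed.

(** The mean value inequality for [F l - F k] bounds its difference quotients uniformly in [l]. In
    the limit, the difference quotients of [f] and [F k] at [c] are uniformly close for one fixed
    large [k]. *)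
Lemma is_derive_ucvg_on a b F f g :
  (exists N, forall k, (N <= k)%N -> forall x, a <= x <= b -> derivable (F k) x 1) ->
  ucvg_on a b F f -> ucvg_on a b (fun k => derive1 (F k)) g ->
  forall c, a < c < b -> is_derive c 1 f (g c).
Proof.
move=> [M dF] Ff Fg c /andP[ac cb].
have cab : a <= c <= b by rewrite !ltW.
suff : h^-1 *: (f (h *: 1 + c) - f c) @[h --> 0^'] --> g c.
  by move=> cv; apply: DeriveDef; [apply/cvg_ex; exists (g c)|exact: cvg_lim].
apply/cvgrPdist_le => e e0.
have e40 : 0 < e / 4 by rewrite divr_gt0.
have [N FN] := Fg _ e40; pose k := maxn M N.
have Mk : (M <= k)%N by rewrite leq_maxl.
have Nk : (N <= k)%N by rewrite leq_maxr.
(* The derivatives of [F l] and [F k] are both within [e / 4] of [g], so increments of [F l - F k]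
   are at most [e / 2] times the distance; this survives the limit in [l]. *)
have fk x : a <= x <= b -> `|(f x - F k x) - (f c - F k c)| <= e / 2 * `|x - c|.
  move=> xab.
  have lx : `|(F l x - F k x) - (F l c - F k c)| @[l --> \oo] -->
      `|(f x - F k x) - (f c - F k c)|.
    by apply: cvg_norm; apply: cvgB; apply: cvgB;
      [exact: ucvg_on_cvg Ff _|exact: cvg_cst|exact: ucvg_on_cvg Ff _|exact: cvg_cst].
  rewrite -(cvg_lim (@Rhausdorff R) lx); apply: limr_le.
    by apply/cvg_ex; eexists; exact: lx.
  near=> l.
  have kl : (k <= l)%N by near: l; exact: nbhs_infty_ge.
  have dkl z : a <= z <= b ->
      is_derive z 1 (fun x => F l x - F k x) (derive1 (F l) z - derive1 (F k) z).
    move=> zab; apply: is_deriveB; apply/is_derive_derive1/dF => //.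
    exact: leq_trans kl.
  apply: (@mean_value_le _ (fun x => F l x - F k x) a b) => // z zab.
    by have [] := dkl z zab.
  have [_] := dkl z zab; rewrite -derive1E => ->.
  rewrite (le_trans (ler_distD (g z) _ _))//.
  have := FN l (leq_trans Nk kl) z zab; have := FN k Nk z zab.
  by rewrite (distrC (g z)); lra.
have := dF k Mk c cab; rewrite /derivable => /cvgrPdist_le/(_ _ e40) nk.
near=> h.
have h0 : h != 0 by near: h; exact: nbhs_dnbhs_neq.
have hab : a <= h + c <= b.
  have hd : `|h| <= Num.min (c - a) (b - c).
    near: h; apply: nbhs_dnbhs; apply: (@nbhs0_le R R).
    by rewrite lt_min !subr_gt0 ac.
  by move: hd; rewrite le_min !ler_norml; lra.
have nkh : `|derive1 (F k) c - h^-1 *: (F k (h *: 1 + c) - F k c)| <= e / 4.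
  by rewrite derive1E; near: h; exact: nk.
have := fk (h + c) hab; rewrite addrK => fkh.
have {fkh}fkh : `|h^-1 * ((f (h + c) - F k (h + c)) - (f c - F k c))| <= e / 2.
  by rewrite normrM normfV mulrC ler_pdivrMr ?normr_gt0.
have gk := FN k Nk c cab.
move: nkh; rewrite /GRing.scale/= mulr1 => nkh.
(* The three terms, at most [e / 4], [e / 4] and [e / 2], come from the convergence of derivatives
   at [c], the derivative of [F k], and the comparison [fkh]. *)
have -> : g c - h^-1 * (f (h + c) - f c) =
  - (derive1 (F k) c - g c) + (derive1 (F k) c - h^-1 * (F k (h + c) - F k c)) -
   h^-1 * ((f (h + c) - F k (h + c)) - (f c - F k c)) by ring.
rewrite (le_trans (ler_normB _ _))// (@le_trans _ _ (e / 4 + e / 4 + e / 2))//.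
  by rewrite lerD// (le_trans (ler_normD _ _))// lerD// normrN.
by lra.
Unshelve. all: by end_near. Qed.

(** Both sequences are treated at once through a cluster point of the pairs in a compact square. The
    index map is not claimed to be increasing: [k <= phi k] is enough to carry over whatever holds
    eventually. *)
Lemma bounded_pair_subsequence (x y : nat -> R) (M : R) (N : nat) :
  (forall k, (N <= k)%N -> `|x k| <= M /\ `|y k| <= M) ->
  exists phi : nat -> nat, [/\ forall k, (k <= phi k)%N,
    cvgn (fun k => x (phi k)) & cvgn (fun k => y (phi k))].
Proof.
move=> bxy; pose z k := (x k, y k).
have cM : compact (`[-M, M] `*` `[-M, M] : set (R * R)).
  by apply: compact_setX; exact: segment_compact.
have [|[p q] [_ zpq]] := cM (z @ \oo) _.
  apply: (filterS _ (nbhs_infty_ge N)) => k /bxy[xM yM].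
  by split => /=; rewrite in_itv/= -ler_norml.
have /choice[phi phiP] : forall n : nat, exists k, (n <= k)%N /\
    (`|x k - p| <= n.+1%:R^-1 /\ `|y k - q| <= n.+1%:R^-1).
  move=> n; have n0 : 0 < n.+1%:R^-1 :> R by rewrite invr_gt0.
  (* The tail from index [n] meets the ball of radius [1 / (n + 1)] about the cluster point. *)
  have := zpq [set w | exists2 k, (n <= k)%N & w = z k] (ball (p, q) n.+1%:R^-1).
  case=> [||w [[k nk ->] [/= xp yq]]].
  - by apply: (filterS _ (nbhs_infty_ge n)) => k nk; exists k.
  - exact: nbhsx_ballx.
  - exists k; split => //; split; rewrite distrC ltW//.
exists phi; split=> [k||].
- by have [] := phiP k.
- apply/cvg_ex; exists p; apply/cvgrPdist_le => e e0.
  near=> k; rewrite distrC; have [_ [+ _]] := phiP k; move/le_trans; apply.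
  by apply/ltW; near: k; exact: near_infty_natSinv_lt (PosNum e0).
- apply/cvg_ex; exists q; apply/cvgrPdist_le => e e0.
  near=> k; rewrite distrC; have [_ [_ +]] := phiP k; move/le_trans; apply.
  by apply/ltW; near: k; exact: near_infty_natSinv_lt (PosNum e0).
Unshelve. all: by end_near. Qed.

End LocallyUniformLimits.

(** * A priori bounds and continuous dependence for the equation in normal form *)

Section SecondOrderODE.
Context {R : realType}.
Variables (A B D : R -> R) (p : R).
Hypotheses (lA : locally_lipschitz A) (lB : locally_lipschitz B)
  (lD : locally_lipschitz D).

Definition rhs (y u v : R) : R := - A y * v + B y * u - D y * u `^ p.

(** The derivatives are two-sided at [a] and [b] as well, so [[a, b]] is meant to lie inside the
    open domain of the solution, and [a = b] still carries information. *)
Definition solves_on (a b : R) (f : R -> R) := forall y, a <= y <= b ->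
  [/\ derivable f y 1, derivable (derive1 f) y 1
    & derive1 (derive1 f) y = rhs y (f y) (derive1 f y)].

Lemma locally_lipschitz_powR (q : R) : locally_lipschitz (fun x : R => x `^ q).
Proof.
have itvP (x : R) : 0 < x -> x \in `]0, +oo[ by rewrite in_itv/= andbT.
apply: C1_locally_lipschitz => x x0; first exact: derivable_powR (itvP x x0).
have cg : {for x, continuous (fun x : R => q * x `^ (q - 1))}.
  apply: cvgM; first exact: cvg_cst.
  exact: (derivable_continuous (derivable_powR (itvP x x0))).
rewrite /prop_for /continuous_at powR_derive1 ?itvP//.
apply: cvg_trans cg; apply: near_eq_cvg; near=> y.
by rewrite powR_derive1// itvP//; near: y; exact: lt_nbhsr.
Unshelve. all: by end_near. Qed.

(** The right-hand side is affine in [v], so [v] need not be bounded; [d > 0] keeps [u] where the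
    power is Lipschitz, whatever the sign of [p]. *)
Lemma rhs_lipschitz (a b d H : R) : 0 < a -> 0 < d ->
  exists2 L, 0 <= L & forall y u u' v v', a <= y <= b ->
    d <= u <= H -> d <= u' <= H ->
    `|rhs y u v - rhs y u' v'| <= L * (`|u - u'| + `|v - v'|).
Proof.
move=> a0 d0.
have [MA MA0 hA] := locally_lipschitz_bounded b lA a0.
have [MB MB0 hB] := locally_lipschitz_bounded b lB a0.
have [MD MD0 hD] := locally_lipschitz_bounded b lD a0.
have [C C0 hC] := locally_lipschitz_powR p H d0.
exists (MA + MB + MD * C) => [|y u u' v v' yab ud ud'].
  by rewrite !addr_ge0// mulr_ge0.
have -> : rhs y u v - rhs y u' v' =
  - (A y * (v - v')) + B y * (u - u') - D y * (u `^ p - u' `^ p).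
  by rewrite /rhs; ring.
apply: (@le_trans _ _ (MA * `|v - v'| + MB * `|u - u'| + MD * (C * `|u - u'|))).
  rewrite (le_trans (ler_normB _ _))// lerD//; last first.
    by rewrite normrM ler_pM// ?hD// hC.
  rewrite (le_trans (ler_normD _ _))// normrN !normrM.
  by rewrite lerD// ler_wpM2r// ?hA ?hB.
have := normr_ge0 (u - u'); have := normr_ge0 (v - v').
move: (`|u - u'|) (`|v - v'|) => s t t0 s0.
have CD : 0 <= MD * C by rewrite mulr_ge0.
rewrite mulrA -subr_ge0.
have -> : (MA + MB + MD * C) * (s + t) - (MA * t + MB * s + MD * C * s) =
  MA * s + MB * t + MD * C * t by ring.
by rewrite !addr_ge0// mulr_ge0.
Qed.

Lemma is_derive_sqr (w : R -> R) (x dw : R) : is_derive x 1 w dw ->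
  is_derive x 1 (fun z => w z ^+ 2) (2 * w x * dw).
Proof.
move=> dwx; have -> : 2 * w x * dw = (2%:R * w x ^+ 1) *: dw by rewrite expr1.
have -> : (fun z => w z ^+ 2) = w ^+ 2 by apply/funext => z; rewrite expr2.
exact: is_deriveX.
Qed.

Lemma solution_derivative_bounded (a b d H : R) : 0 < a -> a < b -> 0 < d ->
  exists M, forall f, solves_on a b f ->
    (forall y, a <= y <= b -> d <= f y <= H) ->
    forall y, a <= y <= b -> `|derive1 f y| <= M.
Proof.
move=> a0 ab d0; have [Hd|Hd] := ltP H d.
  exists 0 => f _ fd; have := fd a; rewrite lexx (ltW ab) => /(_ isT).
  by move=> /andP[/le_trans h /h]; rewrite leNgt Hd.
have [L L0 hL] := rhs_lipschitz b H a0 d0.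
have [MB MB0 hB] := locally_lipschitz_bounded b lB a0.
have [MD MD0 hD] := locally_lipschitz_bounded b lD a0.
(* Comparison with the value at [u = d], [v = 0] gives [|rhs| <= c + L |v|] for [u] in [[d, H]]. *)
pose c := MB * `|d| + MD * `|d `^ p| + L * (H - d).
have c0 : 0 <= c by rewrite !addr_ge0 ?mulr_ge0// subr_ge0.
(* With [t = |f'|], the derivative of [1 + t^2] is at most [2 t (c + L t)], hence at most
   [K (1 + t^2)]. *)
pose K := 2 * (c + L).
(* At a mean value point the slope is at most [(H - d) / (b - a)]; the exponential is the growth
   over the whole interval, and [t <= 1 + t^2] returns from [G] to the slope. *)
exists ((1 + ((H - d) / (b - a)) ^+ 2) * expR (K * (b - a))) => f sf fd y yab.
have rf x : a <= x <= b -> `|rhs x (f x) (derive1 f x)| <= c + L * `|derive1 f x|.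
  move=> xab; have /andP[dfx fxH] := fd x xab.
  have := hL x (f x) d (derive1 f x) 0 xab; rewrite dfx fxH lexx Hd.
  move=> /(_ isT isT); rewrite subr0 => {}hL.
  rewrite -[rhs _ _ _](subrK (rhs x d 0)) (le_trans (ler_normD _ _))//.
  have : `|rhs x d 0| <= MB * `|d| + MD * `|d `^ p|.
    rewrite /rhs mulr0 add0r (le_trans (ler_normB _ _))// !normrM.
    by rewrite lerD// ler_wpM2r// ?hB ?hD.
  have : L * `|f x - d| <= L * (H - d).
    by rewrite ler_wpM2l// ger0_norm ?subr_ge0// lerB.
  by move: hL; rewrite /c mulrDr; lra.
pose G := fun z => 1 + (derive1 f z) ^+ 2.
have dG x : a <= x <= b ->
    is_derive x 1 G (2 * derive1 f x * rhs x (f x) (derive1 f x)).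
  move=> xab; have [_ d2 d2E] := sf x xab; rewrite -d2E.
  rewrite -[X in is_derive _ _ _ X]add0r.
  by apply: is_deriveD; exact/is_derive_sqr/is_derive_derive1.
have gG := @gronwall _ G a b K.
have [|x /andP[ax xb] fx] := @mean_value _ f a b (ltW ab).
  by move=> x /sf[].
have xab : a <= x <= b by rewrite ax.
have fx' : `|derive1 f x| <= (H - d) / (b - a).
  rewrite ler_pdivlMr ?subr_gt0// -(gtr0_norm (_ : 0 < b - a)) ?subr_gt0//.
  rewrite -normrM -fx.
  have aab : a <= a <= b by rewrite lexx ltW.
  have bab : a <= b <= b by rewrite lexx ltW.
  by move: (fd a aab) (fd b bab); rewrite ler_norml; lra.
have {gG}: G y <= G x * expR (K * `|y - x|).
  apply: gG => // z zab; first by have [] := dG z zab.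
  have [_] := dG z zab; rewrite -derive1E => ->.
  rewrite !normrM (ger0_norm (_ : 0 <= 2))// -mulrA /K -mulrA ler_wpM2l//.
  rewrite /G -[X in 1 + X]real_normK ?num_real//.
  apply: (le_trans (ler_wpM2l (normr_ge0 _) (rf z zab))).
  move: (normr_ge0 (derive1 f z)); move: (`|derive1 f z|) => t t0.
  rewrite -subr_ge0.
  have -> : (c + L) * (1 + t ^+ 2) - t * (c + L * t) =
    c * (3 / 4 + (t - 1 / 2) ^+ 2) + L by field.
  by rewrite addr_ge0// mulr_ge0// addr_ge0// sqr_ge0.
move=> Gy; apply: (@le_trans _ _ (G y)).
  rewrite /G -[X in 1 + X]real_normK ?num_real//.
  move: (`|derive1 f y|) => t; rewrite -subr_ge0.
  have -> : 1 + t ^+ 2 - t = 3 / 4 + (t - 1 / 2) ^+ 2 by field.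
  by rewrite addr_ge0// sqr_ge0.
apply: (le_trans Gy); rewrite /G ler_pM ?expR_ge0//.
- by rewrite addr_ge0// sqr_ge0.
- rewrite lerD2l -[X in X <= _]real_normK ?num_real//.
  by rewrite lerXn2r// nnegrE// (le_trans _ fx').
- rewrite ler_expR ler_wpM2l//; first by rewrite mulr_ge0// addr_ge0.
  by move: yab => /andP[ay yb]; rewrite ler_norml; lra.
Qed.

(** [K] depends only on the interval and on [d], [H], so one constant serves every pair in a
    sequence of solutions. *)
Lemma solution_stability (a b d H : R) : 0 < a -> 0 < d ->
  exists K, forall f g, solves_on a b f -> solves_on a b g ->
    (forall y, a <= y <= b -> d <= f y <= H) ->
    (forall y, a <= y <= b -> d <= g y <= H) ->
    forall x y, a <= x <= b -> a <= y <= b ->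
    (f y - g y) ^+ 2 + (derive1 f y - derive1 g y) ^+ 2 <=
    ((f x - g x) ^+ 2 + (derive1 f x - derive1 g x) ^+ 2) * expR (K * `|y - x|).
Proof.
move=> a0 d0; have [L L0 hL] := rhs_lipschitz b H a0 d0.
(* The derivative of the energy is at most [2 s t + 2 t L (s + t)], where [s] and [t] are the
   distances of values and of slopes; this is at most [(1 + 3 L) (s^2 + t^2)]. *)
exists (1 + 3 * L) => f g sf sg fd gd.
pose E z := (f z - g z) ^+ 2 + (derive1 f z - derive1 g z) ^+ 2.
have dE z : a <= z <= b -> is_derive z 1 E
    (2 * (f z - g z) * (derive1 f z - derive1 g z) +
     2 * (derive1 f z - derive1 g z) *
       (rhs z (f z) (derive1 f z) - rhs z (g z) (derive1 g z))).
  move=> zab; have [df d2f <-] := sf z zab; have [dg d2g <-] := sg z zab.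
  have dw := is_deriveB (is_derive_derive1 df) (is_derive_derive1 dg).
  have dw' := is_deriveB (is_derive_derive1 d2f) (is_derive_derive1 d2g).
  exact: (is_deriveD (is_derive_sqr dw) (is_derive_sqr dw')).
apply: (@gronwall _ E) => z zab; first by have [] := dE z zab.
have [_] := dE z zab; rewrite -derive1E => ->.
have hr := hL z (f z) (g z) (derive1 f z) (derive1 g z) zab (fd z zab) (gd z zab).
rewrite (le_trans (ler_normD _ _))// !normrM (ger0_norm (_ : 0 <= 2))//.
rewrite /E -[(f z - g z) ^+ 2]real_normK ?num_real//.
rewrite -[(derive1 f z - derive1 g z) ^+ 2]real_normK ?num_real//.
apply: (le_trans (lerD (lexx _) (ler_wpM2l _ hr))); first by rewrite mulr_ge0.
move: (`|f z - g z|) (`|derive1 f z - derive1 g z|) => s t.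
rewrite -subr_ge0.
have -> : (1 + 3 * L) * (s ^+ 2 + t ^+ 2) - (2 * s * t + 2 * t * (L * (s + t))) =
  (s - t) ^+ 2 + L * ((s - t) ^+ 2 + 2 * s ^+ 2) by ring.
rewrite addr_ge0 ?sqr_ge0// mulr_ge0// addr_ge0 ?sqr_ge0//.
by rewrite mulr_ge0 ?sqr_ge0.
Qed.

End SecondOrderODE.

(** * Compactness of sequences of solutions from convergence of Cauchy data *)

Section Compactness.
Context {R : realType}.

Lemma ucvg_on_itv (a b d H : R) (F : nat -> R -> R) (f : R -> R) x :
  ucvg_on a b F f -> a <= x <= b ->
  (exists N, forall k, (N <= k)%N -> d <= F k x <= H) -> d <= f x <= H.
Proof.
move=> Ff xab [N FN]; have fx := ucvg_on_cvg Ff xab.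
rewrite -(cvg_lim (@Rhausdorff R) fx).
have cF : cvgn (F ^~ x) by apply/cvg_ex; exists (f x).
by apply/andP; split; [apply: limr_ge => //|apply: limr_le => //];
  apply: (filterS _ (nbhs_infty_ge N)) => k /FN /andP[].
Qed.

(** [N], [d] and [H] may depend on the interval, which admits solutions whose domains only exhaust
    the half-line. Stability carries convergence of the data at 1 to every compact interval, and the
    equation carries it to second derivatives. *)
Lemma solution_compactness (A B D : R -> R) (p : R) (f_ : nat -> R -> R) :
  locally_lipschitz A -> locally_lipschitz B -> locally_lipschitz D ->
  (forall a b : R, 0 < a -> exists d H N, 0 < d /\ forall k, (N <= k)%N ->
    solves_on A B D p a b (f_ k) /\ forall y, a <= y <= b -> d <= f_ k y <= H) ->
  exists (phi : nat -> nat) (h : R -> R),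
    [/\ forall k, (k <= phi k)%N,
        forall j (a b : R), (j <= 2)%N -> 0 < a ->
          ucvg_on a b (fun k => derive1n j (f_ (phi k))) (derive1n j h)
      & forall a b : R, 0 < a -> solves_on A B D p a b h].
Proof.
move=> lA lB lD hf.
have [phi [phik cv0 cv1]] : exists phi : nat -> nat, [/\ forall k, (k <= phi k)%N,
    cvgn (fun k => f_ (phi k) 1) & cvgn (fun k => derive1 (f_ (phi k)) 1)].
  have [d [H [N [d0 hN]]]] := hf 1 2 ltr01.
  have [M hM] := solution_derivative_bounded p lA lB lD H ltr01 (ltr1n R 2) d0.
  apply: (@bounded_pair_subsequence _ (fun k => f_ k 1) (fun k => derive1 (f_ k) 1)
    (Num.max H M) N) => k Nk.
  have [sk bk] := hN k Nk.
  have i1 : (1 : R) <= (1 : R) <= (2 : R) by rewrite lexx ler1n.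
  have /andP[dk Hk] := bk 1 i1.
  rewrite !le_max ger0_norm ?(le_trans (ltW d0))// Hk; split=> //.
  by rewrite (hM _ sk bk _ i1) orbT.
pose F k := f_ (phi k).
have hF (a b : R) : 0 < a -> exists d H N, 0 < d /\ forall k, (N <= k)%N ->
    solves_on A B D p a b (F k) /\ forall y, a <= y <= b -> d <= F k y <= H.
  move=> a0; have [d [H [N [d0 hN]]]] := hf a b a0.
  exists d, H, N; split; first exact: d0.
  by move=> k Nk; exact: hN (leq_trans Nk (phik k)).
have cF (a b e : R) : 0 < a -> 0 < e -> exists N, forall k l, (N <= k)%N -> (N <= l)%N ->
    forall x, a <= x <= b ->
    `|F k x - F l x| <= e /\ `|derive1 (F k) x - derive1 (F l) x| <= e.
  (* The interval is enlarged so that it contains 1, where the Cauchy data converge. *)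
  move=> a0 e0; pose a' := Num.min a 1; pose b' := Num.max b 1.
  have a'0 : 0 < a' by rewrite /a' lt_min a0 ltr01.
  have a'1b' : a' <= 1 <= b' by rewrite /a' /b' ge_min le_max lexx !orbT.
  have [d [H [N [d0 hN]]]] := hF a' b' a'0.
  have [K hK] := solution_stability p lA lB lD b' H a'0 d0.
  pose X := expR (`|K| * (b' - a')).
  have X1 : 1 <= X.
    rewrite -expR0 ler_expR mulr_ge0// subr_ge0.
    by move: a'1b' => /andP[]; exact: le_trans.
  have X0 : 0 < X by exact: expR_gt0.
  (* Chosen so that [(e1^2 + e1^2) X = e^2 / (2 X)], which is at most [e^2] because [X >= 1]. *)
  pose e1 := e / (2 * X).
  have e10 : 0 < e1 by rewrite divr_gt0// mulr_gt0.
  have cauchy1 (u : nat -> R) : cvgn u -> exists n, forall k l,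
      (n <= k)%N -> (n <= l)%N -> (u k - u l) ^+ 2 <= e1 ^+ 2.
    move=> /cvgrPdist_le/(_ (e1 / 2)); rewrite divr_gt0// => /(_ isT)[n _ un].
    exists n => k l nk nl; rewrite -[leLHS]real_normK ?num_real//.
    rewrite lerXn2r ?nnegrE ?(ltW e10)//.
    rewrite (le_trans (ler_distD (limn u) _ _))// distrC.
    by rewrite (le_trans (lerD (un _ nk) (un _ nl)))// -splitr.
  have [N0 hN0] := cauchy1 _ cv0; have [N1 hN1] := cauchy1 _ cv1.
  exists (maxn N (maxn N0 N1)) => k l.
  rewrite !geq_max => /and3P[Nk N0k N1k] /and3P[Nl N0l N1l] x /andP[ax xb].
  have xab : a' <= x <= b' by rewrite /a' /b' ge_min le_max ax xb.
  have [[sk bk] [sl bl]] := (hN k Nk, hN l Nl).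
  have := hK _ _ sk sl bk bl 1 x a'1b' xab.
  set E1 := (X in X <= _) => E1le.
  have {E1le} : E1 <= e ^+ 2.
    apply: (le_trans E1le); apply: (@le_trans _ _ ((e1 ^+ 2 + e1 ^+ 2) * X)).
      apply: ler_pM; rewrite ?expR_ge0 ?addr_ge0 ?sqr_ge0//.
        by apply: lerD; [exact: hN0|exact: hN1].
      rewrite ler_expR (@le_trans _ _ (`|K| * `|x - 1|)) ?ler_wpM2r ?ler_norm//.
      rewrite ler_wpM2l//; move: xab a'1b' => /andP[a'x xb'] /andP[a'1 b'1].
      by rewrite ler_norml; apply/andP; split; lra.
    have -> : (e1 ^+ 2 + e1 ^+ 2) * X = e ^+ 2 * (2 * X)^-1.
      by rewrite /e1; field; rewrite gt_eqF.
    rewrite ler_piMr ?sqr_ge0// invf_le1 ?mulr_gt0//; lra.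
  rewrite /E1 => E1le.
  have sq (r : R) : r ^+ 2 <= e ^+ 2 -> `|r| <= e.
    move=> re; rewrite -(ler_pXn2r (isT : (0 < 2)%N)) ?nnegrE ?(ltW e0)//.
    by rewrite real_normK ?num_real.
  by split; apply: sq; apply: le_trans E1le; rewrite ?lerDl ?lerDr sqr_ge0.
pose h (y : R) : R := limn (fun k => F k y); pose g (y : R) : R := limn (fun k => derive1 (F k) y).
have Fh (a b : R) : 0 < a -> ucvg_on a b F h.
  move=> a0; apply: ucauchy_on_ucvg => e e0; have [N hN] := cF a b e a0 e0.
  by exists N => k l Nk Nl x xab; have [] := hN k l Nk Nl x xab.
have Fg (a b : R) : 0 < a -> ucvg_on a b (fun k => derive1 (F k)) g.
  move=> a0; apply: ucauchy_on_ucvg => e e0; have [N hN] := cF a b e a0 e0.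
  by exists N => k l Nk Nl x xab; have [] := hN k l Nk Nl x xab.
(* A compact interval around [y] inside the half-line, on which limits are differentiated. *)
have near_itv (y : R) : 0 < y -> 0 < y / 2 /\ y / 2 < y < 2 * y.
  by move=> y0; split; [|apply/andP; split]; lra.
have dh (y : R) : 0 < y -> is_derive y 1 h (g y).
  move=> /near_itv[y20 ylt].
  apply: (is_derive_ucvg_on _ (Fh _ (2 * y) y20) (Fg _ _ y20) ylt).
  have [d [H [N [_ hN]]]] := hF (y / 2) (2 * y) y20.
  by exists N => k /hN[+ _] x xab => /(_ x xab)[].
have dhE (y : R) : 0 < y -> derive1 h y = g y.
  by move=> /dh[_]; rewrite derive1E.
(* The equation expresses the second derivatives through [F k] and its slope, and the Lipschitz
   bound on [rhs] transfers their uniform convergence. *)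
have Fr (a b : R) : 0 < a -> ucvg_on a b (fun k => derive1 (derive1 (F k)))
    (fun y => rhs A B D p y (h y) (g y)).
  move=> a0 e e0; have [d [H [N [d0 hN]]]] := hF a b a0.
  have [L L0 hL] := rhs_lipschitz p lA lB lD b H a0 d0.
  have L10 : 0 < 2 * (L + 1) by rewrite mulr_gt0// ltr_wpDl.
  have e10 : 0 < e / (2 * (L + 1)) by rewrite divr_gt0.
  have [N0 hN0] := Fh a b a0 _ e10; have [N1 hN1] := Fg a b a0 _ e10.
  exists (maxn N (maxn N0 N1)) => k.
  rewrite !geq_max => /and3P[Nk N0k N1k] x xab; have [sk bk] := hN k Nk.
  have [_ _ ->] := sk x xab.
  have hx : d <= h x <= H.
    apply: (ucvg_on_itv (Fh a b a0) xab); exists N => l Nl.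
    by have [_] := hN l Nl; exact.
  apply: (le_trans (hL _ _ _ _ _ xab (bk x xab) hx)).
  apply: (le_trans (ler_wpM2l L0 (lerD (hN0 k N0k x xab) (hN1 k N1k x xab)))).
  apply: (@le_trans _ _ ((L + 1) * (e / (2 * (L + 1)) + e / (2 * (L + 1))))).
    by rewrite ler_wpM2r ?addr_ge0 ?(ltW e10)// lerDl.
  have -> // : (L + 1) * (e / (2 * (L + 1)) + e / (2 * (L + 1))) = e.
  by field; rewrite gt_eqF// ltr_wpDl.
have ddh (y : R) : 0 < y -> is_derive y 1 (derive1 h) (rhs A B D p y (h y) (g y)).
  move=> /near_itv[y20 ylt].
  apply: (@is_derive_ucvg_on _ (y / 2) (2 * y) (fun k => derive1 (F k)) (derive1 h)
    (fun y => rhs A B D p y (h y) (g y)) _ _ _ _ ylt); last exact: Fr.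
    have [d [H [N [_ hN]]]] := hF (y / 2) (2 * y) y20.
    by exists N => k /hN[+ _] x xab => /(_ x xab)[].
  (* The limit [g] of the slopes is replaced by [derive1 h], which agrees with it for positive
     arguments. *)
  apply: (eq_ucvg_on _ _ (Fg _ (2 * y) y20)); first by exists 0%N.
  by move=> x /andP[/(lt_le_trans y20)/dhE].
have ddhE (y : R) : 0 < y -> derive1 (derive1 h) y = rhs A B D p y (h y) (g y).
  by move=> /ddh[_]; rewrite derive1E.
exists phi, h; split; first exact: phik.
  move=> [|[|[|//]]] a b _ a0.
  - exact: Fh.
  - apply: (eq_ucvg_on _ _ (Fg _ b a0)); first by exists 0%N.
    by move=> x /andP[/(lt_le_trans a0)/dhE].
  - apply: (eq_ucvg_on _ _ (Fr _ b a0)); first by exists 0%N.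
    by move=> x /andP[/(lt_le_trans a0)/ddhE].
move=> a b a0 y /andP[/(lt_le_trans a0) y0 _].
have [dhy _] := dh y y0; have [ddhy _] := ddh y y0.
by split; [exact: dhy|exact: ddhy|rewrite ddhE// dhE].
Qed.

End Compactness.

(** * Derivatives relative to a set: continuity, uniqueness, and agreement with two-sided
    derivatives *)

Section DerivativeWithin.
Context {R : realType}.
Implicit Types (f g : R -> R) (D : set R).

Lemma derivative_within_dist D f x l : derivative_within D f x l ->
  forall e, 0 < e -> exists2 r, 0 < r & forall t, t != 0 -> `|t| < r ->
    D (x + t) -> `|l - t^-1 * (f (x + t) - f x)| <= e.
Proof.
rewrite /derivative_within => /cvgrPdist_le fx e /fx[r /= r0 xr].
exists r => // t t0 tr; apply: xr => //.
by rewrite /ball_ /= sub0r normrN.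
Qed.

(** Near [x] the difference quotients are bounded by [|df x| + 1], so increments of [f] within [D]
    are at most a multiple of the distance. *)
Lemma derivative_within_continuous D f df :
  (forall x, D x -> derivative_within D f x (df x)) -> {within D, continuous f}.
Proof.
move=> dfD; apply/subspace_continuousP => x Dx; apply/cvgrPdist_le => e e0.
have [r r0 xr] := derivative_within_dist (dfD x Dx) ltr01.
pose M := `|df x| + 1.
have M0 : 0 < M by rewrite ltr_wpDl.
have cid : (@id R) @ x --> x by exact: cvg_id.
rewrite near_withinE; near=> y => Dy.
have [->|xy] := eqVneq x y; first by rewrite subrr normr0 ltW.
have yx : x + (y - x) = y by rewrite addrC subrK.
have yxr : `|y - x| < r.
  by rewrite distrC; near: y; exact: (@cvgr_dist_lt _ _ _ _ _ id).
have yxe : `|x - y| <= e / M.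
  by near: y; apply: (@cvgr_dist_le _ _ _ _ _ id) => //; exact: divr_gt0.
have yx0 : y - x != 0 by rewrite subr_eq0 eq_sym.
have := xr (y - x) yx0 yxr; rewrite yx => /(_ Dy) q1.
have : `|(y - x)^-1 * (f y - f x)| <= M.
  rewrite -[X in `|X|](subKr (df x)) (le_trans (ler_normB _ _))//.
  by rewrite /M lerD2l.
rewrite normrM normfV mulrC ler_pdivrMr ?normr_gt0// distrC => /le_trans; apply.
by rewrite mulrC -ler_pdivlMr// distrC.
Unshelve. all: by end_near. Qed.

(** A right neighbourhood of [x] in [D] provides small increments [t > 0] at which one difference
    quotient is close to both limits. It identifies the slope at a left end point. *)
Lemma derivative_within_unique D f x s l l' : 0 < s ->
  `]x, x + s[ `<=` D -> derivative_within D f x l -> derivative_within D f x l' ->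
  l = l'.
Proof.
move=> s0 xsD /derivative_within_dist dl /derivative_within_dist dl'.
apply/eqP; rewrite -subr_eq0 -normr_le0; apply/ler_addgt0Pl => e e0.
have e20 : 0 < e / 2 by rewrite divr_gt0.
have [r r0 xr] := dl _ e20; have [r' r'0 xr'] := dl' _ e20.
pose t := Num.min s (Num.min r r') / 2.
have t0 : 0 < t by rewrite divr_gt0// !lt_min s0 r0.
have : t < Num.min s (Num.min r r').
  by rewrite /t ltr_pdivrMr// ltr_pMr ?ltr1n// !lt_min s0 r0.
rewrite !lt_min => /and3P[ts tr tr'].
have Dt : D (x + t) by apply: xsD; rewrite /= in_itv/= ltrDl t0 ltrD2l.
have := xr t (lt0r_neq0 t0); rewrite gtr0_norm// => /(_ tr Dt).
have := xr' t (lt0r_neq0 t0); rewrite gtr0_norm// => /(_ tr' Dt).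
rewrite addr0 distrC => h' h.
by rewrite (le_trans (ler_distD (t^-1 * (f (x + t) - f x)) _ _))// [leRHS]splitr lerD.
Qed.

Lemma derivative_within_interior (a b : R) f x l : a < x < b ->
  derivative_within `[a, b] f x l -> is_derive x 1 f l.
Proof.
move=> /andP[ax xb] /derivative_within_dist dx.
suff : h^-1 *: (f (h *: 1 + x) - f x) @[h --> 0^'] --> l.
  by move=> cv; apply: DeriveDef; [apply/cvg_ex; exists l|exact: cvg_lim].
apply/cvgrPdist_le => e /dx[r r0 xr].
near=> t; rewrite /GRing.scale/= mulr1 (addrC t).
apply: xr; first by near: t; exact: nbhs_dnbhs_neq.
  by near: t; exact: dnbhs0_lt.
have td : `|t| <= Num.min (x - a) (b - x).
  by near: t; apply: dnbhs0_le; rewrite lt_min !subr_gt0 ax.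
by move: td; rewrite /= in_itv/= le_min !ler_norml; lra.
Unshelve. all: by end_near. Qed.

Lemma within_continuous_at_right (a b : R) f x : a <= x < b ->
  {within `[a, b], continuous f} -> f y @[y --> x^'+] --> f x.
Proof.
move=> /andP[ax xb] cf.
have : {within `[x, b], continuous f}.
  by apply: continuous_subspaceW cf; apply: subset_itv; rewrite bnd_simp.
by move=> /(continuous_within_itvP _ xb)[].
Qed.

End DerivativeWithin.

(** * Signs and regularity of the model coefficients, and the upper bound for truncated solutions *)

Section MarketCoefficients.
Context {R : realType} {n : nat} (m : market R n) (u : preferences R).
Variable alpha : R.
Hypotheses (Hm : standing_assumptions m alpha) (Hu : preference_assumptions u).

(** The denominator is at least [gamma] when [gamma <= 1]; when [gamma > 1], [|rho| <= 1] makes it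
    at least 1. *)
Lemma chi_gt0 : 0 < chi m u.
Proof.
have [_ _ [g0 _] _] := Hu; have [_ [_ _ rho1] _ _ _] := Hm.
have rr0 : 0 <= ((corr m)^T *m corr m) 0 0.
  by rewrite mxE sumr_ge0// => i _; rewrite mxE -expr2 sqr_ge0.
have rr1 : ((corr m)^T *m corr m) 0 0 <= 1.
  by rewrite -(sqr_sqrtr rr0) expr_le1// sqrtr_ge0.
rewrite /chi divr_gt0//.
have [g1|g1] := leP (gamma u) 1.
  by rewrite ltr_pwDl// mulr_ge0// subr_ge0.
have := ler_wnM2l (_ : 1 - gamma u <= 0) rr1; rewrite subr_le0 => /(_ (ltW g1)).
by lra.
Qed.

(** This quotient is [vartheta / psi]; [eta] is a positive multiple of it, and [1 - expo] of its
    inverse. *)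
Lemma gamma_psi_gt0 : 0 < (1 - gamma u) / (psi u - 1).
Proof.
have [_ [p0 p1] _] := Hu; rewrite /vartheta => t0.
have -> : (1 - gamma u) / (psi u - 1) = (1 - gamma u) / (1 - (psi u)^-1) / psi u.
  by field; rewrite subr_eq0 p1 gt_eqF.
exact: divr_gt0.
Qed.

Lemma eta_gt0 : 0 < Defs.eta m u.
Proof.
have [b0 [p0 _] _ _] := Hu.
have -> : Defs.eta m u = beta u `^ psi u * ((1 - gamma u) / (psi u - 1)) / chi m u.
  by rewrite /Defs.eta invfM; ring.
by rewrite divr_gt0 ?chi_gt0// mulr_gt0 ?powR_gt0 ?gamma_psi_gt0.
Qed.

Lemma expo_lt1 : expo m u < 1.
Proof.
rewrite /expo ltrBlDr ltrDl -mulrA mulr_gt0 ?chi_gt0// -invr_gt0 invfM invrK.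
by rewrite mulrC gamma_psi_gt0.
Qed.

(** A nonzero row of the left kernel would be a vector on which the quadratic form of [Sigma]
    vanishes. *)
Lemma Sigma_unit y : 0 < y -> Sigma m y \in unitmx.
Proof.
have [_ _ _ pd _] := Hm => /pd[[_ Spd] _].
rewrite -row_free_unit -kermx_eq0; apply/eqP/row_matrixP => i.
rewrite row0; apply/eqP/negP => /negP ri0.
have := Spd (row i (kermx (Sigma m y)))^T.
rewrite trmx_eq0 ri0 => /(_ isT); rewrite trmxK.
have /sub_kermxP -> : (row i (kermx (Sigma m y)) <= kermx (Sigma m y))%MS.
  exact: row_sub.
by rewrite mul0mx mxE ltxx.
Qed.

Lemma fvol2_locally_lipschitz : locally_lipschitz (fun y => fvol m y ^+ 2).
Proof. by have [_ _ [/Ckalpha_locally_lipschitz]] := Hm. Qed.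

(** Applied with [v = Upsilon] for [btilde] and with [v = drift] for [kappa]. *)
Lemma quadratic_form_locally_lipschitz (v : R -> 'cV[R]_n) :
  (forall i, locally_lipschitz (fun y => v y i 0)) ->
  locally_lipschitz (fun y => ((drift m y)^T *m invmx (Sigma m y) *m v y) 0 0).
Proof.
move=> lv; have [[_ _ lmu] _ [_ lS _] _ _] := Hm.
have lv' : mx_locally_lipschitz v by move=> i j; rewrite ord1.
apply: (mx_locally_lipschitzM _ lv'); apply: mx_locally_lipschitzM.
  apply: mx_locally_lipschitz_tr => i j; rewrite ord1.
  exact: Ckalpha_locally_lipschitz (lmu i).
apply: mx_locally_lipschitz_invmx; first exact: Sigma_unit.
by move=> i j; exact: Ckalpha_locally_lipschitz (lS i j).
Qed.

Lemma btilde_locally_lipschitz : locally_lipschitz (btilde m u).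
Proof.
have [[_ lb _] _ [_ _ lU] _ _] := Hm.
apply: locally_lipschitzD; first exact: Ckalpha_locally_lipschitz lb.
apply: locally_lipschitzN; apply: locally_lipschitzM.
  exact: locally_lipschitz_cst.
apply: quadratic_form_locally_lipschitz => i.
exact: Ckalpha_locally_lipschitz (lU i).
Qed.

Lemma kappa_locally_lipschitz : locally_lipschitz (kappa m u).
Proof.
have [[lr _ lmu] _ _ _ _] := Hm.
apply: locally_lipschitzM; first exact: locally_lipschitz_cst.
apply: locally_lipschitzD; first exact: locally_lipschitz_cst.
apply: locally_lipschitzM; first exact: locally_lipschitz_cst.
apply: locally_lipschitzD; first exact: Ckalpha_locally_lipschitz lr.
apply: locally_lipschitzM; first exact: locally_lipschitz_cst.
apply: quadratic_form_locally_lipschitz => i.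
exact: Ckalpha_locally_lipschitz (lmu i).
Qed.

Lemma solves_odeE (f : R -> R) y : 0 < y -> solves_ode m u f y <->
  derive1 (derive1 f) y =
  rhs (fun y => 2 * btilde m u y * (fvol m y ^+ 2)^-1)
      (fun y => 2 * kappa m u y * (fvol m y ^+ 2)^-1)
      (fun y => 2 * Defs.eta m u * (fvol m y ^+ 2)^-1) (expo m u) y (f y) (derive1 f y).
Proof.
have [_ _ _ pd _] := Hm => /pd[_ a0].
have a0' : fvol m y != 0 by apply: contraTneq a0 => ->; rewrite expr0n ltxx.
rewrite /solves_ode /rhs derive1nS !derive1n1; split=> [E|->]; last by field.
(* A multiple of 0 is subtracted so that this 0 can be replaced by the left-hand side of the
   equation. *)
have -> : derive1 (derive1 f) y = derive1 (derive1 f) y - 2 / fvol m y ^+ 2 * 0.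
  by rewrite mulr0 subr0.
by rewrite -[in X in _ * X]E; field.
Qed.

Variable kappa0 : R.
Hypotheses (k0 : 0 < kappa0) (kk : forall y, 0 < y -> kappa0 <= kappa m u y).

(** Beyond [hbar] one has [x^(1 - p) > eta / kappa0]; multiplication by [x^p] gives the claim. *)
Lemma kappa_dominates (x : R) : hbar m u kappa0 < x ->
  Defs.eta m u * x `^ expo m u < kappa0 * x.
Proof.
rewrite /hbar gt_max => /andP[x1 x2].
have x0 : 0 < x by apply: le_lt_trans x1; rewrite invr_ge0 ltW.
have p1 : 0 < 1 - expo m u by rewrite subr_gt0 expo_lt1.
have ek : 0 <= Defs.eta m u / kappa0 by rewrite divr_ge0 ?ltW// eta_gt0.
have : Defs.eta m u / kappa0 < x `^ (1 - expo m u).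
  rewrite -[X in X < _]powRr1// -[X in _ `^ X < _](mulVf (lt0r_neq0 p1)).
  by rewrite powRrM gt0_ltr_powR// nnegrE ?powR_ge0// ltW.
rewrite ltr_pdivrMr// => h.
have xE : x `^ (1 - expo m u) * x `^ expo m u = x.
  by rewrite -powRD ?subrK ?powRr1 ?(ltW x0)// (gt_eqF x0) implybT.
rewrite -[X in _ < _ * X]xE mulrA ltr_pM2r ?powR_gt0//.
by rewrite mulrC.
Qed.

(* At a maximum point z where f z > hbar the derivative vanishes (if z = eps, by
   the Neumann condition), so the equation forces f'' > 0 just to the right of z,
   against maximality. *)
Lemma classical_solution_le_hbar (eps rad : R) f : 0 < eps -> eps < rad ->
  classical_solution m u eps rad f ->
  forall y, eps <= y <= rad -> f y <= hbar m u kappa0.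
Proof.
move=> e0 er [[Cf [df [cdf dfD]]] _ ode fe fr] y yer.
have cf := derivative_within_continuous dfD.
have [z + fz] := EVT_max (ltW er) cf; rewrite in_itv/= => /andP[ez zr].
apply: le_trans (fz y _) _; first by rewrite in_itv.
rewrite leNgt; apply/negP => hz.
have z0 : 0 < z by exact: lt_le_trans ez.
(* The boundary value [1 / kappa(rad)] is at most [1 / kappa0], hence at most [hbar]. *)
have {}zr : z < rad.
  rewrite lt_neqAle zr andbT; apply: contraTneq hz => ->.
  have kr := kk (lt_trans e0 er).
  by rewrite -leNgt fr /hbar le_max lef_pV2 ?posrE ?kr// (lt_le_trans k0).
have dfI x : eps < x < rad -> is_derive x 1 f (df x).
  move=> xer; apply: (derivative_within_interior xer); apply: dfD.
  by move: xer; rewrite /= in_itv/= => /andP[/ltW-> /ltW->].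
have dfz : df z = 0.
  have [ze|ze] := eqVneq eps z.
    rewrite -ze; apply: (@derivative_within_unique _ `[eps, rad] f eps (rad - eps)) fe.
    - by rewrite subr_gt0.
    - by rewrite addrC subrK; apply: subset_itv; rewrite bnd_simp.
    - by apply: dfD; rewrite /= in_itv/= lexx ltW.
  have zer : eps < z < rad by rewrite zr lt_neqAle ze ez.
  have [_ <-] := dfI z zer.
  have [|||_ ->//] := @derive1_at_max _ f eps rad z (ltW er).
  - by move=> t; rewrite in_itv/= => /dfI[].
  - by rewrite in_itv.
  - by move=> t; rewrite in_itv/= => /andP[/ltW et /ltW tr]; apply: fz; rewrite in_itv/= et.
have kl := kappa_locally_lipschitz; have bl := btilde_locally_lipschitz.
(* By the equation, [q] equals [a^2 f'' / 2] in the interior. Written with [df], it is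
   right-continuous at [z] even when [z = eps]. *)
pose q x := kappa m u x * f x - Defs.eta m u * f x `^ expo m u - btilde m u x * df x.
have fz0 : 0 < f z.
  by apply: lt_trans hz; rewrite /hbar lt_max invr_gt0 k0.
have qz : 0 < q z.
  rewrite /q dfz mulr0 subr0 subr_gt0; apply: lt_le_trans (kappa_dominates hz) _.
  by rewrite ler_wpM2r ?(ltW fz0)// kk.
have zi : eps <= z < rad by rewrite ez.
have cqz : q x @[x --> z^'+] --> q z.
  have fR := within_continuous_at_right zi cf.
  have atR (g : R -> R) : locally_lipschitz g -> g x @[x --> z^'+] --> g z.
    by move=> lg; apply: cvg_at_right_filter; exact: locally_lipschitz_continuous.
  apply: cvgB; last by apply: cvgM; [exact: atR|exact: within_continuous_at_right cdf].
  apply: cvgB; first by apply: cvgM; [exact: atR|].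
  apply: cvgM; first exact: cvg_cst.
  have cp := locally_lipschitz_continuous (locally_lipschitz_powR (expo m u)) fz0.
  exact: (continuous_cvg _ cp fR).
have [r r0 qr] : exists2 r, 0 < r & forall x, z < x < z + r -> x < rad /\ 0 < q x.
  have := cqz => /cvgrPdist_lt/(_ _ qz)[r /= r0 qr].
  exists (Num.min r (rad - z)); first by rewrite lt_min r0 subr_gt0.
  move=> x /andP[zx]; rewrite -ltrBlDl lt_min => /andP[xr xrad].
  split; first by move: xrad; rewrite ltrD2r.
  have := qr x _ zx; rewrite /ball_/= distrC gtr0_norm; last by rewrite subr_gt0.
  by move=> /(_ xr); rewrite ltr_norml => /andP[_]; rewrite ltrBlDr ltrDl.
have zrI x : z < x < z + r -> eps < x < rad.
  by move=> xi; have [-> _] := qr x xi; move: xi => /andP[/(le_lt_trans ez)->].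
have cdfz b : z < b < z + r -> {within `[z, b], continuous df} *
    {within `[z, b], continuous f}.
  move=> /zrI/andP[_ br]; split; [apply: continuous_subspaceW cdf|apply: continuous_subspaceW cf];
  by apply: subset_itv; rewrite bnd_simp// ltW.
(* Since [df z = 0], the mean value theorem for [df] on [[z, b]] turns positivity of [f''] into
   positivity of the slope. *)
have dfpos b : z < b < z + r -> 0 < df b.
  move=> bi; have /andP[zb br] := bi.
  have [x|x xi E] := @MVT _ df (derive1 (derive1 f)) z b zb _ (cdfz b bi).1.
    rewrite in_itv/= => /andP[zx xb]; have xi : z < x < z + r by rewrite zx (lt_trans xb).
    have /andP[ex xr] := zrI x xi.
    have dfE : \forall t \near x, derive1 f t = df t.
      near=> t; rewrite derive1E; have [|_ //] := dfI t.
      by apply/andP; split; near: t; [exact: lt_nbhsr|exact: lt_nbhsl].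
    apply: (near_eq_is_derive dfE); apply: is_derive_derive1.
    by apply: (Cf.1 1%N x isT); rewrite /= in_itv/= ex.
  move: xi E; rewrite in_itv/= => /andP[zx xb]; rewrite dfz subr0 => ->.
  have xi : z < x < z + r by rewrite zx (lt_trans xb).
  rewrite mulr_gt0 ?subr_gt0//.
  have [xrad qx] := qr x xi; have xer := zrI x xi.
  have x0 : 0 < x by exact: lt_trans zx.
  have [_ _ _ pd _] := Hm; have [_ a0] := pd x x0.
  have := ode x; rewrite in_itv/= => /(_ xer); rewrite /solves_ode derive1nS !derive1n1.
  have -> : derive1 f x = df x by rewrite derive1E; have [_ ->] := dfI x xer.
  move=> E; have : 0 < fvol m x ^+ 2 / 2 * derive1 (derive1 f) x.
    by move: qx E; rewrite /q; lra.
  by rewrite pmulr_rgt0// divr_gt0.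
pose b := z + r / 2.
have bi : z < b < z + r by rewrite /b ltrDl divr_gt0//= ltrD2l ltr_pdivrMr// ltr_pMr ?ltr1n.
have /andP[zb br] := bi.
have [x|x] := @MVT _ f df z b zb _ (cdfz b bi).2.
  rewrite in_itv/= => /andP[zx xb]; apply/dfI/zrI; rewrite zx (lt_trans xb)//.
rewrite in_itv/= => /andP[zx xb] E.
have xi : z < x < z + r by rewrite zx (lt_trans xb).
have : 0 < f b - f z by rewrite E mulr_gt0 ?subr_gt0// dfpos.
have /andP[eb brad] := zrI b bi.
by rewrite subr_gt0 ltNge fz// in_itv/= !ltW.
Unshelve. all: by end_near. Qed.

End MarketCoefficients.

(** * Regularity of the second derivative of a positive solution *)

Section SolutionRegularity.
Context {R : realType}.

(** On [[a, b]] the values of [f] stay in a compact interval whose lower end, the minimum of [f], is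
    positive. *)
Lemma locally_lipschitz_comp (f g : R -> R) : (forall x, 0 < x -> 0 < f x) ->
  locally_lipschitz f -> locally_lipschitz g ->
  locally_lipschitz (fun x => g (f x)).
Proof.
move=> f0 lf lg a b a0; have [ab|ba] := leP a b; last first.
  exists 0 => // x y /andP[ax xb].
  by move: ba; rewrite ltNge (le_trans ax xb).
have [|c] := @EVT_min _ f a b ab.
  apply: continuous_in_subspaceT => x; rewrite inE/= in_itv/= => /andP[ax _].
  by apply: locally_lipschitz_continuous => //; exact: lt_le_trans ax.
rewrite in_itv/= => /andP[ac cb] fc.
have fc0 : 0 < f c by rewrite f0// (lt_le_trans a0).
have [M M0 fM] := locally_lipschitz_bounded b lf a0.
have [C C0 fC] := lf a b a0; have [D D0 gD] := lg (f c) M fc0.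
exists (D * C) => [|x y xab yab]; first exact: mulr_ge0.
have fcM z : a <= z <= b -> f c <= f z <= M.
  by move=> zab; rewrite fc ?in_itv//= (le_trans (ler_norm _))// fM.
by rewrite (le_trans (gD _ _ (fcM x xab) (fcM y yab)))// -mulrA ler_wpM2l// fC.
Qed.

(** Bootstrap: [h] is C^1, hence locally Lipschitz; the equation makes [h''] continuous, hence [h']
    locally Lipschitz; then the right-hand side is locally Lipschitz. *)
Lemma solution_locally_lipschitz (A B D : R -> R) (p : R) (h : R -> R) :
  locally_lipschitz A -> locally_lipschitz B -> locally_lipschitz D ->
  (forall y, 0 < y -> 0 < h y) ->
  (forall a b : R, 0 < a -> solves_on A B D p a b h) ->
  locally_lipschitz (derive1 (derive1 h)).
Proof.
move=> lA lB lD h0 sh.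
have sh' (y : R) : 0 < y -> [/\ derivable h y 1, derivable (derive1 h) y 1
    & derive1 (derive1 h) y = rhs A B D p y (h y) (derive1 h y)].
  by move=> y0; apply: (sh y y y0); rewrite lexx.
have lh : locally_lipschitz h.
  apply: C1_locally_lipschitz => y /sh'[d1 d2 _]; first exact: d1.
  exact: derivable_continuous d2.
have lhp := locally_lipschitz_comp h0 lh (locally_lipschitz_powR p).
have ldh : locally_lipschitz (derive1 h).
  apply: C1_locally_lipschitz => y y0; have [_ d2 d2E] := sh' y y0.
    exact: d2.
  have c : (fun z => rhs A B D p z (h z) (derive1 h z)) @ y
      --> rhs A B D p y (h y) (derive1 h y).
    have ct f : locally_lipschitz f -> f @ y --> f y.
      by move=> lf; exact: locally_lipschitz_continuous.
    apply: cvgB; last by apply: cvgM; [exact: ct|exact: (ct _ lhp)].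
    apply: cvgD; apply: cvgM; [|exact: derivable_continuous d2|exact: ct|exact: ct].
    by apply: cvgN; exact: ct.
  rewrite /prop_for /continuous_at d2E; apply: cvg_trans c.
  apply: near_eq_cvg; near=> z.
  by have [|_ _ ->//] := sh' z; near: z; exact: lt_nbhsr.
apply: (@eq_locally_lipschitz _ (fun y => rhs A B D p y (h y) (derive1 h y))).
  by move=> y /sh'[].
apply: locally_lipschitzD; last exact/locally_lipschitzN/locally_lipschitzM.
apply: locally_lipschitzD; last exact: locally_lipschitzM.
exact/locally_lipschitzM/ldh/locally_lipschitzN.
Unshelve. all: by end_near. Qed.

End SolutionRegularity.

(** * Passage to the limit in the truncated problems *)

Theorem lemma3p7 (R : realType) (n : nat) (alpha : R)
    (m : market R n) (u : preferences R)
    (kappa0 Cstar alpha1 alpha2 : R) (h : R -> R -> R -> R)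
    (eps0 delta0 : R) :
  0 < alpha < 1 ->
  standing_assumptions m alpha ->
  preference_assumptions u ->
  0 < kappa0 ->
  (kappa0%:E <= ereal_inf [set (kappa m u y)%:E | y in halfline])%E ->
  0 < Cstar -> 0 <= alpha1 -> 0 <= alpha2 ->
  (forall y, 0 < y ->
    `|fvol m y| + `|btilde m u y| + `|kappa m u y|
      <= Cstar * (1 + Num.max (y `^ (- alpha1)) (y `^ alpha2))) ->
  (forall eps rad, 0 < eps -> eps < rad ->
    unique_classical_solution m u eps rad (h eps rad)) ->
  0 < eps0 < 1 -> 0 < delta0 ->
  (forall eps rad, 0 < eps < eps0 -> 1 < rad ->
    forall y, y \in `[eps, rad] ->
      delta0 * expR (- y - y^-1) <= h eps rad y) ->
  exists (R_ : nat -> R) (hstar : R -> R),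
    [/\ (forall k, 1 < R_ k) /\ R_ k @[k --> \oo] --> +oo,
        Ckalpha halfline 2 alpha hstar,
        forall y, 0 < y -> solves_ode m u hstar y,
        cvg_locally_Ck halfline 2 (fun k => h (R_ k)^-1 (R_ k)) hstar
      & forall y, 0 < y ->
          delta0 * expR (- y - y^-1) <= hstar y <= hbar m u kappa0].
Proof.
move=> al Hm Hu k0 kinf _ _ _ _ hh /andP[e00 _] d00 hlow.
have kk (y : R) : 0 < y -> kappa0 <= kappa m u y.
  move=> y0; rewrite -lee_fin (le_trans kinf)//; apply: ereal_inf_lbound.
  by exists y => //; rewrite /halfline/= in_itv/= y0.
have lV : locally_lipschitz (fun y => (fvol m y ^+ 2)^-1).
  apply: locally_lipschitzV; last exact: fvol2_locally_lipschitz Hm.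
  by move=> y y0; have [_ _ _ pd _] := Hm; rewrite gt_eqF//; have [] := pd y y0.
have lA : locally_lipschitz (fun y => 2 * btilde m u y * (fvol m y ^+ 2)^-1).
  apply: locally_lipschitzM => //; apply: locally_lipschitzM.
    exact: locally_lipschitz_cst.
  exact: btilde_locally_lipschitz Hm.
have lB : locally_lipschitz (fun y => 2 * kappa m u y * (fvol m y ^+ 2)^-1).
  apply: locally_lipschitzM => //; apply: locally_lipschitzM.
    exact: locally_lipschitz_cst.
  exact: kappa_locally_lipschitz Hm.
have lD : locally_lipschitz (fun y => 2 * Defs.eta m u * (fvol m y ^+ 2)^-1).
  by apply: locally_lipschitzM => //; exact: locally_lipschitz_cst.
(* Starting at 2 ensures [1 / r k < 1 < r k] for every [k]. *)
pose r (k : nat) : R := k.+2%:R.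
have hr (T : R) : exists N, forall k, (N <= k)%N -> T < r k.
  exists (Num.truncn T) => k Nk; rewrite (lt_le_trans (truncnS_gt T))//.
  by rewrite ler_nat ltnW// !ltnS.
have r1 k : 1 < r k by rewrite ltr1n.
have r0 k : 0 < r k by rewrite ltr0n.
have rr k : (r k)^-1 < r k by rewrite (lt_trans _ (r1 k))// invf_lt1.
pose f_ k := h (r k)^-1 (r k).
have f_cs k : classical_solution m u (r k)^-1 (r k) (f_ k).
  by have [] := hh (r k)^-1 (r k); rewrite ?invr_gt0.
(* From some index on, [[a, b]] lies inside the truncated domain and [1 / r k < eps0], so both
   bounds are available. *)
have hf (a b : R) : 0 < a -> exists N, forall k, (N <= k)%N ->
    (r k)^-1 < a /\ b < r k /\
    forall y, a <= y <= b -> delta0 * expR (- y - y^-1) <= f_ k y <= hbar m u kappa0.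
  move=> a0; have [N hN] := hr (Num.max b (Num.max a^-1 eps0^-1)).
  exists N => k /hN; rewrite !gt_max => /and3P[bk ak ek].
  have ka : (r k)^-1 < a by rewrite invf_plt ?posrE.
  have ke : (r k)^-1 < eps0 by rewrite invf_plt ?posrE.
  split=> //; split=> // y /andP[ay yb].
  have yk : (r k)^-1 <= y <= r k by rewrite !ltW ?(lt_le_trans ka) ?(le_lt_trans yb).
  rewrite hlow ?in_itv//= ?invr_gt0 ?r0//.
  apply: (classical_solution_le_hbar Hm Hu k0 kk _ (rr k) (f_cs k) yk).
  by rewrite invr_gt0.
have [phi [hs [phik cvj sol]]] : exists (phi : nat -> nat) (hs : R -> R),
    [/\ forall k, (k <= phi k)%N,
        forall j (a b : R), (j <= 2)%N -> 0 < a ->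
          ucvg_on a b (fun k => derive1n j (f_ (phi k))) (derive1n j hs)
      & forall a b : R, 0 < a -> solves_on
          (fun y => 2 * btilde m u y * (fvol m y ^+ 2)^-1)
          (fun y => 2 * kappa m u y * (fvol m y ^+ 2)^-1)
          (fun y => 2 * Defs.eta m u * (fvol m y ^+ 2)^-1) (expo m u) a b hs].
  apply: (solution_compactness lA lB lD) => a b a0; have [N hN] := hf a b a0.
  (* On [[a, b]] the exponent [-y - 1/y] is at least [-b - 1/a]. *)
  exists (delta0 * expR (- b - a^-1)), (hbar m u kappa0), N.
  split=> [|k /hN[ka [bk fk]]]; first by rewrite mulr_gt0// expR_gt0.
  split=> y /[dup] /andP[ay yb] yab.
    have y0 : 0 < y := lt_le_trans a0 ay.
    have yk : `](r k)^-1, (r k)[%classic y.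
      by rewrite /= in_itv/= (lt_le_trans ka)// (le_lt_trans yb).
    have [[[Cf _] _] _ ode _ _] := f_cs k.
    split; [exact: (Cf 0%N y isT yk)|exact: (Cf 1%N y isT yk)|].
    by apply: (solves_odeE u Hm (f_ k) y0).1; apply: ode.
  have /andP[fl ->] := fk y yab; rewrite andbT (le_trans _ fl)//.
  rewrite ler_pM2l// ler_expR lerD ?lerN2// lef_pV2 ?posrE//.
  exact: lt_le_trans ay.
have bnd (y : R) : 0 < y ->
    delta0 * expR (- y - y^-1) <= hs y <= hbar m u kappa0.
  (* The bounds pass to the limit pointwise, on the degenerate interval [[y, y]]. *)
  move=> y0; have yy : y <= y <= y by rewrite lexx.
  apply: (ucvg_on_itv (cvj 0%N y y isT y0) yy); have [N hN] := hf y y y0.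
  by exists N => k Nk; have [_ [_]] := hN _ (leq_trans Nk (phik k)); exact.
have hs0 (y : R) : 0 < y -> 0 < hs y.
  by move=> /bnd/andP[+ _]; apply: lt_le_trans; rewrite mulr_gt0// expR_gt0.
have l2 := solution_locally_lipschitz lA lB lD hs0 sol.
have hl (y : R) : halfline y -> 0 < y by rewrite /halfline/= in_itv/= andbT.
have sol1 (y : R) : 0 < y -> _ := fun y0 => sol y y y0 y (introT andP (conj (lexx y) (lexx y))).
exists (fun k => r (phi k)), hs; split.
- split=> [k|]; first exact: r1.
  (* [phi k >= k] forces the radii to infinity. *)
  apply/cvgryPge => T; have [N hN] := hr T; near=> k; apply/ltW/hN.
  by rewrite (leq_trans _ (phik k))//; near: k; exact: nbhs_infty_ge.
- split; last exact: locally_lipschitz_locally_holder.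
  split=> [[|[|//]] y _ /hl/sol1[]//|y /hl y0].
  exact: locally_lipschitz_continuous.
- by move=> y y0; apply: (solves_odeE u Hm hs y0).2; have [] := sol1 y y0.
- move=> K j cK Kh j2; have [a [b [a0 _ Kab]]] := compact_halfline cK Kh.
  exact: ucvg_on_uniform Kab (cvj j a b j2 a0).
- exact: bnd.
Unshelve. all: by end_near. Qed.
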